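(* Suppose $\bar{\mathcal L}$ is primitive with unique invariant state the full-rank state $\sigma$, and that the spectral gap of its symmetrized generator $\tfrac12(\bar{\mathcal L}^\dagger+\bar{\mathcal L}^{\mathrm{KMS}})$ is bounded below by $\eta>0$. Let $\Lambda>0$ be such that $$\|\sigma^{1/4}H_a\sigma^{-1/4}\|\le\Lambda,\qquad\|\sigma^{1/4}V_a\sigma^{-1/4}\|^2\le\Lambda,\qquad\|\sigma^{1/4}V_a^\dagger\sigma^{-1/4}\|^2\le\Lambda\qquad\text{for all }a\in\mathcal A.$$ For all constants $c_0,C_0>0$ there is a constant $C>0$, depending only on $c_0$ and $C_0$, such that the following holds. Let $M\ge1$ be an integer, $T=\tau M$, and $0<\tau\le c_0\min\{\tfrac1\eta,\tfrac1\Lambda,\tfrac1{T\Lambda^2}\}$, and suppose $$\big\|e^{\tau\mathcal L_a}(\rho)-\mathcal F_\tau(\mathcal L_a)(\rho)\big\|_{\sigma,-1/2}\le C_0\Lambda^2\tau^2\|\rho\|_{\sigma,-1/2}\qquad\text{for all quantum states }\rho\text{ and all }a\in\mathcal A.$$ Then for every initial quantum state $\rho$: (i) the average channel satisfies $$\chi^2\big(\bar{\mathcal E}_{\tau,M}(\rho),\sigma\big)\le C\Big(e^{-2\eta\tau M}\chi^2(\rho,\sigma)+\frac{\tau^2\Lambda^4}{\eta^2}\Big);$$ (ii) the random channel satisfies $$\mathbb E\big[\chi^2(\mathcal E_{\tau,M}(\rho),\sigma)\big]\le C\Big(e^{-2\eta\tau M}\chi^2(\rho,\sigma)+\frac{\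tau\Lambda^2}{\eta}\Big).$$
   Context: $\mathcal H$ is a Hilbert space of finite dimension $N=2^n$, $\mathcal B(\mathcal H)$ is the space of operators on it, $\|\cdot\|$ is the spectral norm. A quantum state is a positive semidefinite operator of trace one; a quantum channel is a completely positive trace-preserving linear map on $\mathcal B(\mathcal H)$. For a full-rank state $\sigma$: the KMS inner product is $\langle X,Y\rangle_{\sigma,1/2}=\operatorname{Tr}(X^\dagger\sigma^{1/2}Y\sigma^{1/2})$ with norm $\|\cdot\|_{\sigma,1/2}$; $\|Y\|_{\sigma,-1/2}^2=\operatorname{Tr}\big(Y^\dagger\sigma^{-1/2}Y\sigma^{-1/2}\big)$; $\chi^2(\rho,\sigma)=\|\rho-\sigma\|_{\sigma,-1/2}^2$; $\mathrm{Var}_\sigma(X)=\|X-\operatorname{Tr}(\sigma X)I\|_{\sigma,1/2}^2$. $(\mathcal A,\mu)$ is a probability space. For each $a\in\mathcal A$, $H_a\in\mathcal B(\mathcal H)$ is Hermitian, $V_a\in\mathcal B(\mathcal H)$, and $$\mathcal L_a(\rho)=-i[H_a,\rho]+V_a\rho V_a^\dagger-\tfrac12\{V_a^\dagger V_a,\rho\},$$ with measurable dependence on $a$. Set $\bar{\mathcal L}=\int_{\mathcal A}\mathcal L_a\,d\mu(a)$. $\bar{\mathcal L}$ is primitive if $e^{t\bar{\mathcal L}}$ has a unique invariant state and it is full-rank. $\bar{\mathcal L}^\dagger$ is the adjoint of $\bar{\mathcal L}$ for the Hilbert–Schmidt inner product $\operatorname{Tr}(X^\dagger Y)$, and $\bar{\mathcal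 L}^{\mathrm{KMS}}$ is the adjoint of $\bar{\mathcal L}^\dagger$ for $\langle\cdot,\cdot\rangle_{\sigma,1/2}$. That the spectral gap of $\mathcal S=\tfrac12(\bar{\mathcal L}^\dagger+\bar{\mathcal L}^{\mathrm{KMS}})$ is bounded below by $\eta$ means $-\langle X,\mathcal S X\rangle_{\sigma,1/2}\ge\eta\,\mathrm{Var}_\sigma(X)$ for all $X\in\mathcal B(\mathcal H)$. For each $a$, $\mathcal F_\tau(\mathcal L_a)$ is a quantum channel (depending measurably on $a$), thought of as an algorithmic approximation of $e^{\tau\mathcal L_a}$. The average channel is $\bar{\mathcal E}_{\tau,M}=\big(\mathbb E_{a\sim\mu}\mathcal F_\tau(\mathcal L_a)\big)^M$. The random channel is $\mathcal E_{\tau,M}=\mathcal F_\tau(\mathcal L_{a_M})\cdots\mathcal F_\tau(\mathcal L_{a_1})$ with $a_1,\dots,a_M$ independent samples from $\mu$; $\mathbb E$ is the expectation over these samples. *)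

(* Defs.v *)
From HB Require Import structures.
From mathcomp Require Import all_boot all_order all_algebra.
From mathcomp Require Import sesquilinear spectral.
From mathcomp Require Import complex.
From mathcomp Require Import all_classical all_reals all_analysis.
Set Implicit Arguments.
Unset Strict Implicit.
Unset Printing Implicit Defensive.
Import Order.TTheory GRing.Theory Num.Theory.
Import numFieldNormedType.Exports.

Local Open Scope classical_set_scope.
Local Open Scope ring_scope.
Local Open Scope complex_scope.
Local Open Scope sesquilinear_scope.

Notation superop R N := ('M[R[i]]_N -> 'M[R[i]]_N) (only parsing).

Section Operators.
Variables (R : realType) (N : nat).
Implicit Types (X Y H V sigma rho : 'M[R[i]]_N) (L Phi Psi : superop R N).

Definition is_psd (m : nat) (X : 'M[R[i]]_m) : Prop :=
  X \is hermsymmx /\ forall v : 'cV[R[i]]_m, 0 <= (v^t* *m X *m v) 0 0.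

Definition is_state rho : Prop := is_psd rho /\ \tr rho = 1.

Definition full_rank rho : Prop := \rank rho = N.

(* Functional calculus x |-> x `^ s on the eigenvalues; meaningful for
   positive semidefinite sigma when 0 <= s, and for positive definite sigma
   for every real exponent s. *)
Definition mxpowR sigma (s : R) : 'M[R[i]]_N :=
  let P := spectralmx sigma in
  invmx P *m diag_mx (map_mx (fun x => (complex.Re x `^ s)%:C)
                             (spectral_diag sigma)) *m P.

Definition vec_norm (v : 'cV[R[i]]_N) : R :=
  Num.sqrt (complex.Re ((v^t* *m v) 0 0)).

Definition spectral_norm X : R :=
  sup [set vec_norm (X *m v) | v in [set v | vec_norm v = 1]].

Definition hs_ip X Y : R[i] := \tr (X^t* *m Y).

Definition kms_ip sigma X Y : R[i] :=
  \tr (X^t* *m mxpowR sigma 2^-1 *m Y *m mxpowR sigma 2^-1).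

Definition kms_norm sigma X : R := Num.sqrt (complex.Re (kms_ip sigma X X)).

Definition kms_dual_norm sigma Y : R :=
  Num.sqrt (complex.Re
    (\tr (Y^t* *m mxpowR sigma (- 2^-1) *m Y *m mxpowR sigma (- 2^-1)))).

Definition chi2 rho sigma : R := kms_dual_norm sigma (rho - sigma) ^+ 2.

Definition kms_var sigma X : R :=
  kms_norm sigma (X - (\tr (sigma *m X))%:M) ^+ 2.

Definition is_adjoint (ip : 'M[R[i]]_N -> 'M[R[i]]_N -> R[i]) Phi Psi : Prop :=
  forall X Y, ip X (Phi Y) = ip (Psi X) Y.

(* The inequality is in the order of R[i], so it also says that
   <X, S X> is real. *)
Definition spectral_gap_ge sigma (S : superop R N) (eta : R) : Prop :=
  forall X, (eta * kms_var sigma X)%:C <= - kms_ip sigma X (S X).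

Definition trace_preserving Phi : Prop := forall X, \tr (Phi X) = \tr X.

(* id_k \otimes Phi acts blockwise on k x k block matrices with N x N blocks. *)
Definition completely_positive Phi : Prop :=
  forall (k : nat) (X : 'I_k -> 'I_k -> 'M[R[i]]_N),
    is_psd (\mxblock_(i < k, j < k) X i j) ->
    is_psd (\mxblock_(i < k, j < k) Phi (X i j)).

Definition is_channel Phi : Prop :=
  [/\ linear Phi, completely_positive Phi & trace_preserving Phi].

Definition lindblad H V : superop R N := fun rho =>
  - ('i%C *: (H *m rho - rho *m H)) + V *m rho *m V^t*
  - 2^-1 *: (V^t* *m V *m rho + rho *m (V^t* *m V)).

(* e^{tL} X, as the sum of the exponential series applied to X. *)
Definition superexp (t : R) L : superop R N := fun X =>
  limn (series (fun k : nat => (t ^+ k / k`!%:R)%:C *: iter k L X)).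

Definition invariant_state L rho : Prop :=
  is_state rho /\ forall t : R, 0 <= t -> superexp t L rho = rho.

Definition primitive L : Prop :=
  exists2 sigma, unique (invariant_state L) sigma & full_rank sigma.

End Operators.

Section RandomSuperoperators.
Context (R : realType) (N : nat) (d : measure_display) (A : measurableType d).
Implicit Types (mu : probability A R) (G : A -> superop R N).

Definition measurable_superop G : Prop :=
  forall X (i j : 'I_N),
    measurable_fun setT (fun a => complex.Re (G a X i j)) /\
    measurable_fun setT (fun a => complex.Im (G a X i j)).

Definition mean_superop mu G : superop R N := fun X =>
  \matrix_(i, j) ((\int[mu]_a complex.Re (G a X i j)) +i*
                  (\int[mu]_a complex.Im (G a X i j))).

(* G (a_M) (... (G (a_1) X)) for the sequence s = [:: a_1; ...; a_M]. *)
Definition composed_superop G (s : seq A) : superop R N := fun X =>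
  foldl (fun Y a => G a Y) X s.

End RandomSuperoperators.

Definition iid_samples (R : realType) (d d' : measure_display)
    (Omega : measurableType d) (A : measurableType d')
    (P : probability Omega R) (mu : probability A R) (M : nat)
    (a : 'I_M -> {RV P >-> A}) : Prop :=
  (forall i B, measurable B -> distribution P (a i) B = mu B) /\
  (forall (J : {set 'I_M}) (B : 'I_M -> set A),
     (forall i, measurable (B i)) ->
     P [set w | forall i, i \in J -> B i (a i w)] =
     (\prod_(i in J) P (a i @^-1` B i))%E).

(* Main.v *)
(* Conjugating by sigma^(1/4), the dual KMS norm becomes the Hilbert-Schmidt norm,
   for which every L_a has norm at most 4 Lambda. Hence one step of the algorithm
   is rho + tau L_a rho up to O(Lambda^2 tau^2) |rho|. For D = rho - sigma, which
   is traceless and orthogonal to sigma, the gap gives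
   Re <D, Lbar D> <= - eta |D|^2.
   For the average channel this yields
   |D'| <= exp (- eta tau + O(Lambda^2 tau^2)) |D| + O(Lambda^2 tau^2).
   For the random channel, the first-order term of |D'|^2 is averaged over the new
   sample, and the fluctuations contribute O(Lambda^2 tau^2) |rho|^2, so
   E |D'|^2 <= exp (- 2 eta tau + O(Lambda^2 tau^2)) E |D|^2 + O(Lambda^2 tau^2).
   Both recursions are summed as geometric series; the factors
   exp (O(Lambda^2 tau^2)) accumulate to a constant since tau T Lambda^2 <= c0.
   Conditioning on the past is replaced by an expansion in real coordinates: the
   products of two coordinates of the trajectory at time m are functions of the
   first m samples only, in the sense of a product rule. *)

Require Import Defs.
From HB Require Import structures.
From mathcomp Require Import all_boot all_order all_algebra.
From mathcomp Require Import sesquilinear spectral.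
From mathcomp Require Import complex.
From mathcomp Require Import all_classical all_reals all_analysis.
From mathcomp Require Import measurable_realfun ring lra.
Import Order.TTheory GRing.Theory Num.Theory.
Import numFieldNormedType.Exports.
Set Implicit Arguments.
Unset Strict Implicit.
Unset Printing Implicit Defensive.
Local Open Scope classical_set_scope.
Local Open Scope ring_scope.
Local Open Scope complex_scope.
Local Open Scope sesquilinear_scope.

(** * Weighted Hilbert-Schmidt geometry *)

(** The obstacle is that the errors are proportional to |rho| and not to |D|, so contraction alone
    cannot absorb them. But [sigma] is a unit vector representing the trace, hence |rho|^2 = 1 +
    |D|^2, and each error splits into a part proportional to D, moved into the exponent, and a
    constant part. The constant part, of order Lambda^2 tau^2 per step against a contraction rate of
    order eta tau, saturates at tau Lambda^2 / eta. In (i) this level is reached by the norm, so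
    chi-square gets its square; in (ii) the recursion is already for the squared norm. The
    algorithmic error is controlled on states only. States span all matrices by polarization, so the
    channels are still bounded on each matrix uniformly in the sample, and every integrand is
    bounded and measurable. Only real parts of inner products occur: norms and the gap involve
    nothing else, and the weighted product becomes a symmetric real bilinear form. *)

Section RealInequalities.
Variable R : realType.
Implicit Types a b d t x y : R.

Lemma discriminant_le a b d :
  0 <= d -> (forall t, 0 <= a + 2 * t * b + t ^+ 2 * d) -> b ^+ 2 <= a * d.
Proof.
move=> d0 q; have [d0'|d0'] := eqVneq d 0.
  have [->|b0] := eqVneq b 0; first by rewrite d0' mulr0 expr0n.
  (* For [d = 0] the polynomial is affine in [t], and this [t] gives it the value -1. *)
  have := q (- (a + 1) / (2 * b)); rewrite d0' mulr0 addr0.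
  have -> : a + 2 * (- (a + 1) / (2 * b)) * b = -1 by field.
  by rewrite leNgt ltrN10.
have dp : 0 < d by rewrite lt_neqAle eq_sym d0' d0.
(* The minimizer of the quadratic polynomial. *)
have := q (- b / d).
have -> : a + 2 * (- b / d) * b + (- b / d) ^+ 2 * d = (a * d - b ^+ 2) / d by field.
by rewrite pmulr_lge0 ?invr_gt0 // subr_ge0.
Qed.

Lemma ler_of_sqr x y : 0 <= y -> x ^+ 2 <= y ^+ 2 -> x <= y.
Proof.
move=> y0; have [x0|x0] := lerP 0 x; last by rewrite (le_trans (ltW x0)).
by rewrite ler_pXn2r ?nnegrE.
Qed.

End RealInequalities.

HB.lock Definition fdot (R : realType) (N : nat) (X Y : 'M[R[i]]_N) : R :=
  complex.Re (\tr (X^t* *m Y)).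

(* For [W = sigma^(-1/4)] this is the real part of the inner product whose norm
   is [kms_dual_norm sigma]. *)
HB.lock Definition wdot (R : realType) (N : nat) (W X Y : 'M[R[i]]_N) : R :=
  fdot (W *m X *m W) (W *m Y *m W).

HB.lock Definition wnorm (R : realType) (N : nat) (W X : 'M[R[i]]_N) : R :=
  Num.sqrt (wdot W X X).

Section FrobeniusGeometry.
Variables (R : realType) (N : nat).
Local Notation C := R[i].
Local Notation E := 'M[R[i]]_N.
Implicit Types (W X Y Z : E) (c : R).

Lemma ReM_real c (z : C) : complex.Re (c%:C * z) = c * complex.Re z.
Proof. by case: z => a b /=; rewrite mul0r subr0. Qed.

Lemma ImM_real c (z : C) : complex.Im (c%:C * z) = c * complex.Im z.
Proof. by case: z => a b /=; rewrite mul0r addr0. Qed.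

Lemma ReD (z1 z2 : C) : complex.Re (z1 + z2) = complex.Re z1 + complex.Re z2.
Proof. by case: z1; case: z2. Qed.

Lemma ImD (z1 z2 : C) : complex.Im (z1 + z2) = complex.Im z1 + complex.Im z2.
Proof. by case: z1; case: z2. Qed.

Lemma Re_sum (I : Type) (s : seq I) (P : pred I) (F : I -> C) :
  complex.Re (\sum_(i <- s | P i) F i) = \sum_(i <- s | P i) complex.Re (F i).
Proof.
by apply: (big_ind2 (fun z x => complex.Re z = x)) => // x1 x2 y1 y2 <- <-; rewrite ReD.
Qed.

Lemma Im_sum (I : Type) (s : seq I) (P : pred I) (F : I -> C) :
  complex.Im (\sum_(i <- s | P i) F i) = \sum_(i <- s | P i) complex.Im (F i).
Proof.
by apply: (big_ind2 (fun z x => complex.Im z = x)) => // x1 x2 y1 y2 <- <-; rewrite ImD.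
Qed.

Lemma Re_conj (z : C) : complex.Re z^* = complex.Re z.
Proof. by case: z. Qed.

Lemma conjRC c : (c%:C)^* = c%:C :> C.
Proof. exact: conjc_real. Qed.

Lemma dagM m n p (X : 'M[C]_(m, n)) (Y : 'M[C]_(n, p)) :
  (X *m Y)^t* = Y^t* *m X^t*.
Proof. by rewrite trmx_mul map_mxM. Qed.

Lemma dagD m n (X Y : 'M[C]_(m, n)) : (X + Y)^t* = X^t* + Y^t*.
Proof. by rewrite linearD /= map_mxD. Qed.

Lemma dagZ m n (a : C) (X : 'M[C]_(m, n)) : (a *: X)^t* = a^* *: X^t*.
Proof. by rewrite linearZ /= map_mxZ. Qed.

Lemma dagK m n (X : 'M[C]_(m, n)) : (X^t*)^t* = X.
Proof. exact: trmxCK. Qed.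

Lemma mxtrace_dag X : \tr (X^t*) = (\tr X)^*.
Proof.
rewrite /mxtrace rmorph_sum /=; apply: eq_bigr => i _.
by rewrite !mxE.
Qed.


Lemma fdotE X Y : fdot X Y = \sum_i \sum_j
  (complex.Re (X i j) * complex.Re (Y i j) + complex.Im (X i j) * complex.Im (Y i j)).
Proof.
rewrite !fdot.unlock /mxtrace Re_sum exchange_big; apply: eq_bigr => j _ /=.
rewrite mxE Re_sum; apply: eq_bigr => i _; rewrite !mxE.
by case: (X i j) => a b; case: (Y i j) => a' b' /=; rewrite mulNr opprK.
Qed.

Lemma fdotC X Y : fdot X Y = fdot Y X.
Proof.
by rewrite !fdotE; do 2!apply: eq_bigr => ? _; rewrite mulrC [X in _ + X]mulrC.
Qed.

Lemma fdotDr X Y Z : fdot X (Y + Z) = fdot X Y + fdot X Z.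
Proof. by rewrite !fdot.unlock mulmxDr mxtraceD ReD. Qed.

Lemma fdotZr c X Y : fdot X (c%:C *: Y) = c * fdot X Y.
Proof. by rewrite !fdot.unlock -scalemxAr mxtraceZ ReM_real. Qed.

Lemma fdotMl X Y Z : fdot (X *m Y) Z = fdot Y (X^t* *m Z).
Proof. by rewrite !fdot.unlock dagM mulmxA. Qed.

Lemma fdotMr X Y Z : fdot (X *m Y) Z = fdot X (Z *m Y^t*).
Proof. by rewrite !fdot.unlock dagM -mulmxA mxtrace_mulC mulmxA. Qed.

Lemma fdot_dag X Y : fdot (X^t*) (Y^t*) = fdot X Y.
Proof.
by rewrite !fdot.unlock dagK -[LHS]Re_conj -mxtrace_dag dagM dagK mxtrace_mulC.
Qed.

Lemma fdot_ge0 X : 0 <= fdot X X.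
Proof.
rewrite fdotE; do 2!apply: sumr_ge0 => ? _.
by rewrite -!expr2 addr_ge0 ?sqr_ge0.
Qed.

Lemma fdot_eq0 X : fdot X X = 0 -> X = 0.
Proof.
rewrite fdotE => /eqP; rewrite psumr_eq0; last first.
  by move=> i _; apply: sumr_ge0 => j _; rewrite -!expr2 addr_ge0 ?sqr_ge0.
move=> /allP h; apply/matrixP => i j; rewrite mxE.
have := h i (mem_index_enum i); rewrite psumr_eq0; last first.
  by move=> k _; rewrite -!expr2 addr_ge0 ?sqr_ge0.
move=> /allP /(_ j (mem_index_enum j)); rewrite -!expr2 paddr_eq0 ?sqr_ge0 //.
by rewrite !sqrf_eq0; case: (X i j) => a b /= /andP[/eqP -> /eqP ->].
Qed.


Lemma wdotC W X Y : wdot W X Y = wdot W Y X.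
Proof. by rewrite !wdot.unlock fdotC. Qed.

Lemma wdotDr W X Y Z : wdot W X (Y + Z) = wdot W X Y + wdot W X Z.
Proof. by rewrite !wdot.unlock mulmxDr mulmxDl fdotDr. Qed.

Lemma wdotZr W c X Y : wdot W X (c%:C *: Y) = c * wdot W X Y.
Proof. by rewrite !wdot.unlock -scalemxAr -scalemxAl fdotZr. Qed.

Lemma wdotNr W X Y : wdot W X (- Y) = - wdot W X Y.
Proof.
by rewrite -scaleN1r -[X in X *: _](_ : (-1)%:C = _) ?wdotZr ?mulN1r// rmorphN1.
Qed.

Lemma wdotBr W X Y Z : wdot W X (Y - Z) = wdot W X Y - wdot W X Z.
Proof. by rewrite wdotDr wdotNr. Qed.

Lemma wdotDl W X Y Z : wdot W (Y + Z) X = wdot W Y X + wdot W Z X.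
Proof. by rewrite wdotC wdotDr ![wdot W X _]wdotC. Qed.

Lemma wdotZl W c X Y : wdot W (c%:C *: Y) X = c * wdot W Y X.
Proof. by rewrite wdotC wdotZr wdotC. Qed.

Lemma wdotBl W X Y Z : wdot W (Y - Z) X = wdot W Y X - wdot W Z X.
Proof. by rewrite wdotC wdotBr ![wdot W X _]wdotC. Qed.

Lemma wdot0r W X : wdot W X 0 = 0.
Proof. by rewrite -(subrr X) wdotBr subrr. Qed.

Lemma wdot_ge0 W X : 0 <= wdot W X X.
Proof. by rewrite wdot.unlock fdot_ge0. Qed.

Lemma wnorm_ge0 W X : 0 <= wnorm W X.
Proof. by rewrite wnorm.unlock sqrtr_ge0. Qed.

Lemma sqr_wnorm W X : wnorm W X ^+ 2 = wdot W X X.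
Proof. by rewrite wnorm.unlock sqr_sqrtr ?wdot_ge0. Qed.

Lemma wdot_le W X Y : wdot W X Y <= wnorm W X * wnorm W Y.
Proof.
apply: ler_of_sqr; first by rewrite mulr_ge0 ?wnorm_ge0.
rewrite (exprMn _ (wnorm W X)) !sqr_wnorm; apply: discriminant_le => [|t]; first exact: wdot_ge0.
have := wdot_ge0 W (X + t%:C *: Y).
rewrite wdotDr !wdotDl !wdotZr !wdotZl (wdotC W Y).
move: (wdot W X X) (wdot W X Y) (wdot W Y Y) => a b d.
by rewrite (_ : _ + _ = a + 2 * t * b + t ^+ 2 * d) //; ring.
Qed.

End FrobeniusGeometry.

(* Linearity over the real scalars only: the coordinates below are the real and
   imaginary parts of the entries. *)
Definition rlinear (R : realType) (N : nat) (f : 'M[R[i]]_N -> R) : Prop :=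
  forall c X Y, f (c%:C *: X + Y) = c * f X + f Y.

(** * Real coordinates of matrices and the weighted norm *)

Section Coordinates.
Variables (R : realType) (N : nat).
Local Notation C := R[i].
Local Notation E := 'M[R[i]]_N.
Local Notation idx := ('I_N * 'I_N * bool)%type.
Implicit Types (W X Y Z : E) (c : R) (p q : idx) (f : E -> R).

(* The boolean in an index selects the imaginary part. *)
Definition mbase p : E := (if p.2 then 'i%C else 1) *: delta_mx p.1.1 p.1.2.

Definition coord p X : R :=
  if p.2 then complex.Im (X p.1.1 p.1.2) else complex.Re (X p.1.1 p.1.2).

Lemma big_idx (V : nmodType) (F : idx -> V) :
  \sum_p F p = \sum_i \sum_j (F (i, j, true) + F (i, j, false)).
Proof.
rewrite pair_big /= (eq_bigr (fun ij : 'I_N * 'I_N => \sum_(b : bool) F (ij, b))).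
  by rewrite pair_big /=; apply: eq_bigr => -[].
by move=> [i j] _; rewrite big_bool.
Qed.

Lemma coord_base X : X = \sum_p (coord p X)%:C *: mbase p.
Proof.
rewrite big_idx {1}[X]matrix_sum_delta; apply: eq_bigr => i _; apply: eq_bigr => j _.
rewrite /coord /mbase /= !scalerA -scalerDl; congr (_ *: _).
by rewrite mulr1 addrC {1}[X i j]complexE [_%:C * 'i%C]mulrC.
Qed.

Lemma coord_rlinear p : rlinear (coord p).
Proof.
move=> c X Y; rewrite /coord; case: p.2; rewrite !mxE.
  by rewrite ImD ImM_real.
by rewrite ReD ReM_real.
Qed.

Lemma wdot_rlinear W Z : rlinear (wdot W Z).
Proof. by move=> c X Y; rewrite wdotDr wdotZr. Qed.

Lemma rlinear0 f : rlinear f -> f 0 = 0.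
Proof.
move=> fl; have := fl 1 0 0; rewrite scaler0 addr0 mul1r => /eqP.
by rewrite -subr_eq0 opprD addrA subrr sub0r oppr_eq0 => /eqP.
Qed.

Lemma rlinear_sum f (I : finType) (a : I -> R) (B : I -> E) : rlinear f ->
  f (\sum_i (a i)%:C *: B i) = \sum_i a i * f (B i).
Proof.
move=> fl; apply: (big_ind2 (fun X x => f X = x)); first exact: rlinear0.
  by move=> X x Y y <- <-; rewrite -[X]scale1r fl mul1r scale1r.
by move=> i _; rewrite -[_ *: _]addr0 fl rlinear0 // addr0.
Qed.

Lemma rlinear_coord f X : rlinear f -> f X = \sum_p coord p X * f (mbase p).
Proof. by move=> fl; rewrite {1}[X]coord_base rlinear_sum. Qed.

Lemma wdot_coord W X Y :
  wdot W X Y = \sum_p \sum_q coord p X * coord q Y * wdot W (mbase p) (mbase q).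
Proof.
rewrite wdotC (rlinear_coord X (@wdot_rlinear W Y)); apply: eq_bigr => p _.
rewrite wdotC (rlinear_coord Y (@wdot_rlinear W (mbase p))) mulr_sumr.
by apply: eq_bigr => q _; rewrite mulrA.
Qed.

Lemma coord_fdot p X : coord p X = fdot (mbase p) X.
Proof.
case: p => [[i j] b]; rewrite fdotE /coord (bigD1 i) //= (bigD1 j) //=.
rewrite /mbase /= !mxE !eqxx mulr1 big1 ?addr0; last first.
  by move=> k /negPf kj; rewrite !mxE kj andbF mulr0 /= !mul0r addr0.
rewrite big1 ?addr0; last first.
  by move=> k /negPf ki; rewrite big1 // => l _; rewrite !mxE ki mulr0 /= !mul0r addr0.
by case: b; rewrite /= ?mul0r ?mul1r ?add0r ?addr0.
Qed.

Lemma wdot_le_norm W X Y : `|wdot W X Y| <= wnorm W X * wnorm W Y.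
Proof.
rewrite ler_norml wdot_le andbT lerNl -wdotNr.
have -> : wnorm W Y = wnorm W (- Y) by rewrite wnorm.unlock wdotNr wdotC wdotNr opprK.
exact: wdot_le.
Qed.

(** The witness is the weighted norm of the Riesz representative of [coord p] for [wdot W]:
    conjugating it by [W] gives [U^t* *m mbase p *m U^t*], which cancels the two factors [W] on the
    other side. Bounds in the weighted norm thereby reach the entries, where measurability and
    convergence are checked. *)
Lemma coord_le W : W \in unitmx ->
  forall p, exists2 c, 0 <= c & forall X, `|coord p X| <= c * wnorm W X.
Proof.
move=> Wu p; set U := invmx W; exists (wnorm W (U *m U^t* *m mbase p *m (U^t* *m U))).
  exact: wnorm_ge0.
move=> X; rewrite (_ : coord p X = wdot W (U *m U^t* *m mbase p *m (U^t* *m U)) X).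
  exact: wdot_le_norm.
rewrite coord_fdot wdot.unlock.
have -> : W *m (U *m U^t* *m mbase p *m (U^t* *m U)) *m W = U^t* *m mbase p *m U^t*.
  by rewrite -!mulmxA (mulVmx Wu) mulmx1 !mulmxA (mulmxV Wu) mul1mx.
rewrite fdotMr fdotMl !dagK; congr fdot.
by rewrite !mulmxA (mulVmx Wu) mul1mx -mulmxA (mulmxV Wu) mulmx1.
Qed.

Lemma wnormD W X Y : wnorm W (X + Y) <= wnorm W X + wnorm W Y.
Proof.
apply: ler_of_sqr; first by rewrite addr_ge0 ?wnorm_ge0.
rewrite sqrrD !sqr_wnorm wdotDr !wdotDl (wdotC W Y X).
by have := wdot_le W X Y; rewrite -mulr_natl; lra.
Qed.

Lemma wnormZ W c X : wnorm W (c%:C *: X) = `|c| * wnorm W X.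
Proof.
by rewrite wnorm.unlock wdotZr wdotZl mulrA -expr2 sqrtrM ?sqr_ge0 // sqrtr_sqr.
Qed.

Lemma wnormN W X : wnorm W (- X) = wnorm W X.
Proof. by rewrite wnorm.unlock wdotNr wdotC wdotNr opprK. Qed.

Lemma wnormB W X Y : wnorm W (X - Y) <= wnorm W X + wnorm W Y.
Proof. by rewrite -(wnormN W Y) wnormD. Qed.

Lemma wnorm0 W : wnorm W 0 = 0.
Proof. by rewrite wnorm.unlock wdot0r sqrtr0. Qed.

Lemma wnormi W X : wnorm W ('i%C *: X) = wnorm W X.
Proof.
rewrite wnorm.unlock; congr Num.sqrt; rewrite wdot.unlock fdot.unlock.
rewrite -!scalemxAr -!scalemxAl dagZ -scalemxAr -scalemxAl scalerA.
rewrite (_ : 'i%C * _ = 1) ?scale1r //; apply/eqP.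
by rewrite eq_complex /= !(mul0r, mulr0, mul1r, mulr1, mulrN1, mulrN, opprK,
  addr0, add0r, sub0r, oppr0) !eqxx.
Qed.

Lemma wnormZC W (a : C) X :
  wnorm W (a *: X) <= (`|complex.Re a| + `|complex.Im a|) * wnorm W X.
Proof.
rewrite [a]complexE scalerDl mulrDl; apply: le_trans (wnormD _ _ _) _.
by rewrite -scalerA wnormi !wnormZ /= !(mul0r, mulr0, add0r, addr0, subr0, mul1r).
Qed.

Lemma wnorm_sum W (I : Type) (s : seq I) (P : pred I) (F : I -> E) :
  wnorm W (\sum_(k <- s | P k) F k) <= \sum_(k <- s | P k) wnorm W (F k).
Proof.
apply: (big_ind2 (fun X x => wnorm W X <= x)); first by rewrite wnorm0.
  by move=> X x Y y hX hY; apply: le_trans (wnormD _ _ _) _; exact: lerD.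
by [].
Qed.

Lemma wnorm_eq0 W X : W \in unitmx -> wdot W X X = 0 -> X = 0.
Proof.
move=> Wu; rewrite wdot.unlock => /fdot_eq0 h.
by rewrite -[X](mulKmx Wu) -[X in _ *m X](mulmxK Wu) h mul0mx mulmx0.
Qed.

End Coordinates.

(** * Spectral norm bounds for multiplication in the Frobenius norm *)

Section SpectralNorm.
Variables (R : realType) (N : nat).
Local Notation C := R[i].
Local Notation E := 'M[R[i]]_N.
Local Notation fro := (@wnorm R N 1%:M).
Implicit Types (X Y Z : E) (v : 'cV[C]_N).

Lemma sqr_vecE v : complex.Re ((v^t* *m v) 0 0) =
  \sum_i (complex.Re (v i 0) ^+ 2 + complex.Im (v i 0) ^+ 2).
Proof.
rewrite mxE Re_sum; apply: eq_bigr => i _; rewrite !mxE.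
by case: (v i 0) => a b /=; rewrite mulNr opprK !expr2.
Qed.

Lemma sqr_vec_norm v : vec_norm v ^+ 2 =
  \sum_i (complex.Re (v i 0) ^+ 2 + complex.Im (v i 0) ^+ 2).
Proof.
by rewrite /vec_norm sqr_vecE sqr_sqrtr // sumr_ge0 // => i _; rewrite addr_ge0 ?sqr_ge0.
Qed.

Lemma vec_norm_ge0 v : 0 <= vec_norm v.
Proof. exact: sqrtr_ge0. Qed.

Lemma vec_normZ (c : R) v : vec_norm (c%:C *: v) = `|c| * vec_norm v.
Proof.
apply/eqP; rewrite -(@eqrXn2 _ 2) ?mulr_ge0 ?vec_norm_ge0 //.
rewrite exprMn !sqr_vec_norm real_normK ?num_real // mulr_sumr; apply/eqP.
by apply: eq_bigr => i _; rewrite !mxE ReM_real ImM_real !exprMn mulrDr.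
Qed.

Lemma vec_norm_entry v i :
  `|complex.Re (v i 0)| <= vec_norm v /\ `|complex.Im (v i 0)| <= vec_norm v.
Proof.
have h : complex.Re (v i 0) ^+ 2 + complex.Im (v i 0) ^+ 2 <= vec_norm v ^+ 2.
  rewrite sqr_vec_norm (bigD1 i) //= lerDl sumr_ge0 // => j _.
  by rewrite addr_ge0 ?sqr_ge0.
have := sqr_ge0 (complex.Re (v i 0)); have := sqr_ge0 (complex.Im (v i 0)).
by split; apply: ler_of_sqr; rewrite ?vec_norm_ge0 ?real_normK ?num_real //; lra.
Qed.

Lemma vec_norm_eq0 v : vec_norm v = 0 -> v = 0.
Proof.
move=> v0; apply/matrixP => i j; rewrite ord1 mxE.
have [] := vec_norm_entry v i; rewrite v0 !normr_le0 => /eqP h1 /eqP h2.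
by case: (v i 0) h1 h2 => a b /= -> ->.
Qed.

(** A [sup] says nothing about its set unless the set is bounded, so this comes before any use of
    [spectral_norm]. The bound is crude: the entries of a unit vector have real and imaginary parts
    of modulus at most 1, so both parts of entry [i] of the image are at most [a i]. *)
Lemma spectral_norm_has_ub X :
  has_ubound [set vec_norm (X *m v) | v in [set v : 'cV[C]_N | vec_norm v = 1]].
Proof.
pose a i := \sum_j (`|complex.Re (X i j)| + `|complex.Im (X i j)|).
have a0 i : 0 <= a i by apply: sumr_ge0 => j _; rewrite addr_ge0.
exists (Num.sqrt (\sum_i (a i ^+ 2 + a i ^+ 2))) => _ [v v1 <-].
have vE i : `|complex.Re (v i 0)| <= 1 /\ `|complex.Im (v i 0)| <= 1.
  by rewrite -v1; exact: vec_norm_entry.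
have b (x y z t : R) : `|z| <= 1 -> `|t| <= 1 -> `|x * z + y * t| <= `|x| + `|y|.
  move=> z1 t1; apply: le_trans (ler_normD _ _) _.
  by rewrite !normrM lerD // ler_piMr.
have sqa x i : `|x| <= a i -> x ^+ 2 <= a i ^+ 2.
  by move=> h; rewrite -(real_normK (num_real x)) ler_pXn2r ?nnegrE.
rewrite /vec_norm sqr_vecE ler_sqrt; last first.
  by apply: sumr_ge0 => i _; rewrite addr_ge0 ?sqr_ge0.
apply: ler_sum => i _; rewrite mxE Re_sum Im_sum.
apply: lerD; apply: sqa; apply: le_trans (ler_norm_sum _ _ _) _.
  apply: ler_sum => j _; case: (vE j); case: (X i j) (v j 0) => [x y] [z t] /= hz ht.
  by rewrite -(normrN y) -mulNr; exact: b.
apply: ler_sum => j _; case: (vE j); case: (X i j) (v j 0) => [x y] [z t] /= hz ht.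
exact: b.
Qed.

Lemma vec_norm_mul_le X v : vec_norm (X *m v) <= spectral_norm X * vec_norm v.
Proof.
have [v0|v0] := eqVneq (vec_norm v) 0.
  rewrite v0 mulr0 (vec_norm_eq0 v0) mulmx0.
  by rewrite -(scale0r (0 : 'cV[C]_N)) (vec_normZ 0 0) normr0 mul0r.
have vp : 0 < vec_norm v by rewrite lt_neqAle eq_sym v0 vec_norm_ge0.
set u := (vec_norm v)^-1%:C *: v.
have u1 : vec_norm u = 1.
  by rewrite /u vec_normZ ger0_norm ?invr_ge0 ?vec_norm_ge0 // mulVf.
have : vec_norm (X *m u) <= spectral_norm X.
  by apply: (ub_le_sup (spectral_norm_has_ub X)); exists u.
rewrite /u -scalemxAr vec_normZ ger0_norm ?invr_ge0 ?vec_norm_ge0 //.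
by rewrite mulrC ler_pdivrMr.
Qed.

Lemma wdot1 X Y : wdot 1%:M X Y = fdot X Y.
Proof. by rewrite wdot.unlock !mul1mx !mulmx1. Qed.

Lemma fdot_col X : fdot X X = \sum_j vec_norm (col j X) ^+ 2.
Proof.
rewrite fdotE exchange_big; apply: eq_bigr => j _ /=.
by rewrite sqr_vec_norm; apply: eq_bigr => i _; rewrite !mxE !expr2.
Qed.

Lemma wnorm_fro (W X : E) : wnorm W X = fro (W *m X *m W).
Proof. by rewrite !wnorm.unlock wdot1 wdot.unlock. Qed.

Lemma sqr_fro X : fro X ^+ 2 = fdot X X.
Proof. by rewrite sqr_wnorm wdot1. Qed.

Lemma fro_dag X : fro (X^t*) = fro X.
Proof. by rewrite wnorm.unlock !wdot1 fdot_dag. Qed.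

Lemma fro_mull X Y s : spectral_norm X <= s -> 0 <= s -> fro (X *m Y) <= s * fro Y.
Proof.
move=> Xs s0; apply: ler_of_sqr; first by rewrite mulr_ge0 ?wnorm_ge0.
rewrite exprMn !sqr_fro !fdot_col mulr_sumr; apply: ler_sum => j _.
rewrite -exprMn ler_pXn2r ?nnegrE ?mulr_ge0 ?vec_norm_ge0 //.
rewrite -[col j _]/(col j (X *m Y)) colE -mulmxA -colE.
by apply: le_trans (vec_norm_mul_le _ _) _; rewrite ler_wpM2r ?vec_norm_ge0.
Qed.

(** By duality |X^t* Y|^2 = <Y, X X^t* Y> <= |Y| s |X^t* Y|, and one factor cancels. This spares a
    comparison of the spectral norms of a matrix and of its adjoint. *)
Lemma fro_mull_dag X Y s :
  spectral_norm X <= s -> 0 <= s -> fro (X^t* *m Y) <= s * fro Y.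
Proof.
move=> Xs s0; have [->|a0] := eqVneq (fro (X^t* *m Y)) 0.
  by rewrite mulr_ge0 ?wnorm_ge0.
have ap : 0 < fro (X^t* *m Y) by rewrite lt_neqAle eq_sym a0 wnorm_ge0.
rewrite -(ler_pM2r ap) -expr2 sqr_fro fdotMl dagK -wdot1.
apply: le_trans (wdot_le _ _ _) _.
rewrite mulrAC mulrC ler_wpM2r ?wnorm_ge0 //; exact: fro_mull.
Qed.

Lemma fro_mulr X Y s : spectral_norm X <= s -> 0 <= s -> fro (Y *m X) <= s * fro Y.
Proof. by move=> Xs s0; rewrite -fro_dag dagM -(fro_dag Y) fro_mull_dag. Qed.

End SpectralNorm.

(** * Functional calculus, Lindbladians and the spectral gap *)

Section SpectralCalculus.
Variables (R : realType) (N : nat).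
Local Notation C := R[i].
Local Notation E := 'M[R[i]]_N.
Implicit Types (X Y Z : E).

Lemma hermsymmxP m (X : 'M[C]_m) : X \is hermsymmx <-> X^t* = X.
Proof.
split=> [/is_hermitianmxP|h]; first by rewrite expr0 scale1r => <-.
by apply/is_hermitianmxP; rewrite expr0 scale1r h.
Qed.

Variable sigma : E.
Hypotheses (psd : is_psd sigma) (rk : full_rank sigma).
Let P := spectralmx sigma.
Let lam := spectral_diag sigma.

Let Pu : P \is unitarymx. Proof. exact: spectral_unitarymx. Qed.
Let PPd : P *m P^t* = 1%:M. Proof. exact/unitarymxP. Qed.

Lemma sigma_spectral : sigma = P^t* *m diag_mx lam *m P.
Proof.
have /hermitian_normalmx /orthomx_spectralP -> := psd.1.
by rewrite invmx_unitary.
Qed.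

Lemma spectral_diag_gt0 j : 0 < lam 0 j.
Proof.
rewrite lt_def; apply/andP; split.
  apply/eqP => l0.
  have : sigma \in unitmx by rewrite -row_free_unit /row_free rk.
  rewrite sigma_spectral unitmxE !det_mulmx det_diag (bigD1 j) //= l0.
  by rewrite mul0r mulr0 mul0r unitr0.
(* The test vector is the eigenvector of [lam 0 j], so the quadratic form returns that
   eigenvalue. *)
have := psd.2 ((row j P)^t*); rewrite dagK {1}sigma_spectral.
have -> : row j P *m (P^t* *m diag_mx lam *m P) *m (row j P)^t* =
   row j (P *m P^t*) *m diag_mx lam *m (row j (P *m P^t*))^t*.
  by rewrite !row_mul dagM dagK !mulmxA.
rewrite PPd mul_mx_diag mxE (bigD1 j) //= big1 ?addr0 => [|k /negPf kj].
  by rewrite !mxE eqxx mul1r rmorph1 mulr1.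
by rewrite !mxE eq_sym kj !mul0r.
Qed.

Let Re_lam_gt0 j : 0 < complex.Re (lam 0 j).
Proof. by have := spectral_diag_gt0 j; rewrite ltcE => /andP[]. Qed.

Let lamE j : lam 0 j = (complex.Re (lam 0 j))%:C.
Proof.
have := spectral_diag_gt0 j; rewrite ltcE => /andP[/eqP /=].
by case: (lam 0 j) => a b /= ->.
Qed.

Let pw s : 'rV[C]_N := map_mx (fun x => (complex.Re x `^ s)%:C) lam.

Lemma mxpowRE s : mxpowR sigma s = P^t* *m diag_mx (pw s) *m P.
Proof. by rewrite /mxpowR (invmx_unitary Pu). Qed.

Lemma mxpowRD s t : mxpowR sigma s *m mxpowR sigma t = mxpowR sigma (s + t).
Proof.
rewrite !mxpowRE.
have -> : P^t* *m diag_mx (pw s) *m P *m (P^t* *m diag_mx (pw t) *m P) =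
    P^t* *m diag_mx (pw s) *m (P *m P^t*) *m diag_mx (pw t) *m P by rewrite !mulmxA.
rewrite PPd mulmx1 -(mulmxA (P^t*)) mulmx_diag.
suff -> : \row_j (pw s 0 j * pw t 0 j) = pw (s + t) by [].
apply/rowP => j; rewrite !mxE.
rewrite -rmorphM powRD //; apply/implyP => _; rewrite gt_eqF //; exact: Re_lam_gt0.
Qed.

Lemma mxpowR0 : mxpowR sigma 0 = 1%:M.
Proof.
have p0 : pw 0 = const_mx 1 by apply/rowP => j; rewrite !mxE powRr0.
by rewrite mxpowRE p0 diag_const_mx mulmx1; apply: mulmx1C.
Qed.

Lemma mxpowR1 : mxpowR sigma 1 = sigma.
Proof.
have p1 : pw 1 = lam by apply/rowP => j; rewrite mxE powRr1 ?ltW // -lamE.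
by rewrite mxpowRE p1 -sigma_spectral.
Qed.

Lemma mxpowR_dag s : (mxpowR sigma s)^t* = mxpowR sigma s.
Proof.
have pr : map_mx Num.conj (diag_mx (pw s))^T = diag_mx (pw s).
  rewrite tr_diag_mx map_diag_mx; congr diag_mx.
  by apply/rowP => j; rewrite !mxE; exact: conjRC.
by rewrite mxpowRE !dagM dagK pr mulmxA.
Qed.

End SpectralCalculus.

(** * Multiplications and Lindbladians in the weighted norm *)

Section WeightedGeometry.
Variables (R : realType) (N : nat).
Local Notation C := R[i].
Local Notation E := 'M[R[i]]_N.
Local Notation fro := (@wnorm R N 1%:M).
Implicit Types (X Y Z : E).
Variables (W U : E).
Hypotheses (Wd : W^t* = W) (Ud : U^t* = U) (WU : W *m U = 1%:M).

Let UW : U *m W = 1%:M. Proof. exact: mulmx1C. Qed.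

Lemma wdot_fdot X Y : wdot W X Y = fdot (W *m W *m X *m W *m W) Y.
Proof.
by rewrite wdot.unlock fdotC fdotMr fdotMl Wd fdotC !mulmxA.
Qed.

(** [W] and [U] will be the powers -1/4 and 1/4 of [sigma]. Conjugation turns multiplication in the
    weighted norm into multiplication by [W *m A *m U] and [U *m B *m W] in the Frobenius norm. *)
Lemma frob_sandwich A X B : W *m (A *m X *m B) *m W =
  (W *m A *m U) *m (W *m X *m W) *m (U *m B *m W).
Proof.
rewrite !mulmxA -(mulmxA (W *m A) U W) UW mulmx1.
by rewrite -(mulmxA (W *m A *m X) W U) WU mulmx1.
Qed.

(** Left multiplication becomes [W *m A *m U], the adjoint of [U *m A^t* *m W]; right multiplication
    involves [U *m A *m W] itself. This is why bounds on both [V] and its adjoint enter. *)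
Lemma wnorm_mull A X s : spectral_norm (U *m A^t* *m W) <= s -> 0 <= s ->
  wnorm W (A *m X) <= s * wnorm W X.
Proof.
move=> As s0; rewrite (wnorm_fro W (A *m X)) (wnorm_fro W X) -[A *m X]mulmx1.
rewrite frob_sandwich mulmx1 UW mulmx1.
have -> : W *m A *m U = (U *m A^t* *m W)^t* by rewrite !dagM Wd Ud dagK mulmxA.
exact: fro_mull_dag.
Qed.

Lemma wnorm_mulr A X s : spectral_norm (U *m A *m W) <= s -> 0 <= s ->
  wnorm W (X *m A) <= s * wnorm W X.
Proof.
move=> As s0; rewrite (wnorm_fro W (X *m A)) (wnorm_fro W X) -[in X *m A](mul1mx X).
rewrite frob_sandwich mulmx1 WU !mul1mx.
exact: fro_mulr.
Qed.

Variable Lam : R.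
Hypothesis Lam0 : 0 <= Lam.

(** Each factor [V] or [V^t*] costs the square root of [Lam]. The constant is 4 = 2 + 1 + 1:
    commutator, jump term, half of the anticommutator. *)
Lemma wnorm_lindblad H V X : H^t* = H ->
  spectral_norm (U *m H *m W) <= Lam ->
  spectral_norm (U *m V *m W) ^+ 2 <= Lam ->
  spectral_norm (U *m V^t* *m W) ^+ 2 <= Lam ->
  wnorm W (lindblad H V X) <= 4 * Lam * wnorm W X.
Proof.
move=> Hd hH hV hVd.
pose r := Num.sqrt Lam.
have r0 : 0 <= r by exact: sqrtr_ge0.
have rr : r * r = Lam by rewrite -expr2 sqr_sqrtr.
have {}hV : spectral_norm (U *m V *m W) <= r.
  by apply: ler_of_sqr; rewrite // [leRHS]expr2 rr.
have {}hVd : spectral_norm (U *m V^t* *m W) <= r.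
  by apply: ler_of_sqr; rewrite // [leRHS]expr2 rr.
have hVdd : spectral_norm (U *m (V^t*)^t* *m W) <= r by rewrite dagK.
have b1 : wnorm W (H *m X) <= Lam * wnorm W X by apply: wnorm_mull; rewrite ?Hd.
have b2 : wnorm W (X *m H) <= Lam * wnorm W X by exact: wnorm_mulr.
have rX Y Z : wnorm W Y <= r * wnorm W Z -> wnorm W Z <= r * wnorm W X ->
    wnorm W Y <= Lam * wnorm W X.
  by move=> h1 h2; rewrite (le_trans h1) // -rr -mulrA ler_wpM2l.
have b3 : wnorm W (V *m X *m V^t*) <= Lam * wnorm W X.
  exact: (rX _ (V *m X) (wnorm_mulr (V *m X) hVd r0) (wnorm_mull X hVd r0)).
have b4 : wnorm W (V^t* *m V *m X) <= Lam * wnorm W X.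
  by rewrite -mulmxA; apply: (rX _ _ (wnorm_mull (V *m X) hVdd r0) (wnorm_mull X hVd r0)).
have b5 : wnorm W (X *m (V^t* *m V)) <= Lam * wnorm W X.
  by rewrite mulmxA; apply: (rX _ _ (wnorm_mulr (X *m V^t*) hV r0) (wnorm_mulr X hVd r0)).
rewrite /lindblad.
have -> : 4 * Lam * wnorm W X = (2 * (Lam * wnorm W X) + Lam * wnorm W X) + Lam * wnorm W X.
  by ring.
apply: le_trans (wnormB _ _ _) _; apply: lerD.
  apply: le_trans (wnormD _ _ _) _; apply: lerD => //.
  rewrite wnormN wnormi; apply: le_trans (wnormB _ _ _) _.
  by rewrite mulr2n mulrDl !mul1r lerD.
have -> : (2^-1 : C) = (2^-1)%:C by rewrite fmorphV rmorph_nat.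
rewrite wnormZ ger0_norm ?invr_ge0 // mulrC ler_pdivrMr // mulrC.
by apply: le_trans (wnormD _ _ _) _; rewrite mulr2n mulrDl !mul1r lerD.
Qed.

End WeightedGeometry.

Section KmsGeometry.
Variables (R : realType) (N : nat).
Local Notation C := R[i].
Local Notation E := 'M[R[i]]_N.
Implicit Types (X Y Z : E).
Section QuarterPowers.
Variable sigma : E.
Hypotheses (psd : is_psd sigma) (rk : full_rank sigma).

Lemma mxpowR_quarterV : mxpowR sigma (- 4^-1) *m mxpowR sigma 4^-1 = 1%:M.
Proof. by rewrite (mxpowRD psd rk) addNr mxpowR0. Qed.

Lemma mxpowR_halfV : mxpowR sigma 2^-1 *m mxpowR sigma (- 2^-1) = 1%:M.
Proof. by rewrite (mxpowRD psd rk) subrr mxpowR0. Qed.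

Lemma mxpowR_quarterN_sqr :
  mxpowR sigma (- 4^-1) *m mxpowR sigma (- 4^-1) = mxpowR sigma (- 2^-1).
Proof.
have e : - 4^-1 - 4^-1 = - 2^-1 :> R by field.
by rewrite (mxpowRD psd rk) e.
Qed.

Lemma mxpowR_half_sqr : mxpowR sigma 2^-1 *m mxpowR sigma 2^-1 = sigma.
Proof.
have e : 2^-1 + 2^-1 = 1 :> R by field.
by rewrite (mxpowRD psd rk) e (mxpowR1 psd rk).
Qed.

End QuarterPowers.

(* [W], [S] and [T] stand for the powers -1/4, 1/2 and -1/2 of [sigma]. *)
Variables (sigma W S T : E).
Hypotheses (Sdef : mxpowR sigma 2^-1 = S) (Tdef : mxpowR sigma (- 2^-1) = T).
Hypotheses (Wd : W^t* = W) (Sd : S^t* = S) (Wu : W \in unitmx).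
Hypotheses (WW : W *m W = T) (ST : S *m T = 1%:M) (SS : S *m S = sigma).

Let TS : T *m S = 1%:M. Proof. exact: (mulmx1C ST). Qed.



Let wdotT X Y : wdot W X Y = fdot (T *m X *m T) Y.
Proof. by rewrite (wdot_fdot Wd) -WW !mulmxA. Qed.

Lemma kms_dual_normE Y : kms_dual_norm sigma Y = wnorm W Y.
Proof.
by rewrite /kms_dual_norm wnorm.unlock Tdef wdotT fdotC fdot.unlock !mulmxA.
Qed.

Lemma chi2E X : chi2 X sigma = wdot W (X - sigma) (X - sigma).
Proof. by rewrite /chi2 kms_dual_normE sqr_wnorm. Qed.

(** The weight cancels [sigma], as [T *m sigma *m T] is the identity. Thus [sigma] represents the
    trace, and traceless matrices are orthogonal to it. *)
Lemma wdot_sigmal Y : wdot W sigma Y = complex.Re (\tr Y).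
Proof.
rewrite wdotT -SS.
have -> : T *m (S *m S) *m T = 1%:M by rewrite (mulmxA T S S) TS mul1mx ST.
by rewrite fdot.unlock trmx1 map_mx1 mul1mx.
Qed.

Lemma Re_kms_ip X Y : complex.Re (kms_ip sigma X Y) = fdot X (S *m Y *m S).
Proof. by rewrite fdot.unlock /kms_ip Sdef !mulmxA. Qed.

Lemma Re_hs_ip X Y : complex.Re (hs_ip X Y) = fdot X Y.
Proof. by rewrite fdot.unlock. Qed.

Let fdotS X Y : fdot X (S *m Y *m S) = fdot (S *m X *m S) Y.
Proof. by rewrite [RHS]fdotMr fdotMl Sd mulmxA. Qed.

Section Gap.
Variables (Lbar Ldag LKMS : superop R N) (eta : R).
Hypotheses (adj : is_adjoint (@hs_ip R N) Lbar Ldag)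
  (adjK : is_adjoint (kms_ip sigma) Ldag LKMS) (eta0 : 0 < eta)
  (gap : spectral_gap_ge sigma (fun X => 2^-1 *: (Ldag X + LKMS X)) eta).

Let STY Y : S *m (T *m Y *m T) *m S = Y.
Proof. by rewrite !mulmxA ST mul1mx -mulmxA TS mulmx1. Qed.

(** With [X = T *m Y *m T], the adjunctions show that [Ldag] and [LKMS] have the same real quadratic
    form at [X], equal to that of [Lbar] at [Y]. So the gap of the symmetrized generator is a
    dissipation estimate for [Lbar] itself. *)
Lemma wdot_generator Y :
  wdot W Y (Lbar Y) <= - (eta * kms_var sigma (T *m Y *m T)).
Proof.
have YE := STY Y; rewrite (wdotT Y (Lbar Y)); move: (T *m Y *m T) YE => X YE.
have := gap X; rewrite lecE => /andP[_].
have -> : (2^-1 : C) = (2^-1)%:C by rewrite fmorphV rmorph_nat.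
rewrite raddfN /= Re_kms_ip -scalemxAr -scalemxAl fdotZr mulmxDr mulmxDl fdotDr.
have eD : fdot X (S *m Ldag X *m S) = fdot X (Lbar Y).
  by rewrite fdotS YE fdotC -Re_hs_ip -adj Re_hs_ip.
have eK : fdot X (S *m LKMS X *m S) = fdot X (S *m Ldag X *m S).
  by rewrite fdotS fdotC -Re_kms_ip -adjK Re_kms_ip.
rewrite eK eD; move: (fdot _ _) (eta * _) => x y; lra.
Qed.

Lemma wdot_generator_le0 Y : wdot W Y (Lbar Y) <= 0.
Proof.
apply: le_trans (wdot_generator Y) _.
by rewrite oppr_le0 mulr_ge0 ?(ltW eta0) // sqr_ge0.
Qed.

Lemma wdot_generator_traceless Y : \tr Y = 0 ->
  wdot W Y (Lbar Y) <= - (eta * wdot W Y Y).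
Proof.
move=> Y0; apply: le_trans (wdot_generator Y) _.
rewrite (wdotT Y Y); have := wdot_ge0 W Y; rewrite (wdotT Y Y).
have YE := STY Y; move: (T *m Y *m T) YE => X YE X0.
(* A traceless [Y] corresponds to a centered observable [X], whose variance is its squared KMS norm,
   that is |Y|^2. *)
have tX : \tr (sigma *m X) = 0.
  by rewrite -SS -mulmxA mxtrace_mulC YE.
have eX : X - (\tr (sigma *m X))%:M = X by rewrite tX raddf0 subr0.
by rewrite /kms_var eX /kms_norm Re_kms_ip YE sqr_sqrtr.
Qed.

(* Perturbing [sigma] in the dissipation inequality [<Y, Lbar Y> <= 0], the
   first-order term is [<Lbar sigma, Lbar sigma>] because [Lbar] annihilates
   the trace, so it must vanish. *)
Lemma generator_sigma0 :
  (forall c X Y, Lbar (c%:C *: X + Y) = c%:C *: Lbar X + Lbar Y) ->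
  (forall X, \tr (Lbar X) = 0) -> Lbar sigma = 0.
Proof.
move=> lin tr0; set Z := Lbar sigma.
apply: (wnorm_eq0 Wu); apply/eqP; rewrite eq_le wdot_ge0 andbT.
have q (t : R) : 0 <= t -> t * wdot W Z Z + t ^+ 2 * wdot W Z (Lbar Z) <= 0.
  move=> t0; have := wdot_generator_le0 (t%:C *: Z + sigma).
  rewrite lin !(wdotDr, wdotDl, wdotZr, wdotZl) -/Z !wdot_sigmal !tr0 /= mulr0 !addr0.
  by move: (wdot _ _ _) (wdot _ _ _) => x y; rewrite expr2 -!mulrA addrC.
rewrite leNgt; apply/negP => a0.
move: (wdot W Z Z) (wdot W Z (Lbar Z)) a0 q => a b a0 q.
have bn : - b <= `|b| by rewrite -normrN ler_norm.
have n0 := normr_ge0 b; move: (`|b|) bn n0 => n bn n0.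
have d0 : 0 < n + a by lra.
(* With [n] the absolute value of [b], this [t] satisfies t (- b) <= t n < a, so the first-order
   term wins. The summand [a] in the denominator covers the case [b = 0]. *)
have t0 : 0 < a / (2 * (n + a)) by rewrite divr_gt0 // mulr_gt0.
have := q _ (ltW t0); apply/negP; rewrite -ltNge.
have tE t : t * a + t ^+ 2 * b = t * (a + t * b) :> R by ring.
rewrite tE mulr_gt0 //.
have : a / (2 * (n + a)) * - b < a; last by rewrite mulrN; lra.
apply: (@le_lt_trans _ _ (a / (2 * (n + a)) * n)).
  by rewrite ler_wpM2l // ltW.
rewrite mulrAC ltr_pdivrMr ?mulr_gt0 // ltr_pM2l //; lra.
Qed.

End Gap.
End KmsGeometry.

(** * Second-order expansion of the exponential *)

Section ExponentialSeries.
Variables (R : realType) (N : nat).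
Local Notation C := R[i].
Local Notation E := 'M[R[i]]_N.
Implicit Types (X Y Z : E).

(** Radii of balls over [R[i]] are themselves elements of [R[i]]; a positive one is real, and is
    compared through its real part. *)
Lemma normc_lt (z e : C) : 0 < e ->
  `|complex.Re z| + `|complex.Im z| < complex.Re e -> `|z| < e.
Proof.
rewrite ltcE => /andP[/eqP /= e1 e2]; case: e e1 e2 => a b /= -> _.
rewrite -[a +i* 0]/(a%:C) normc_def ltcR; apply: le_lt_trans.
case: z => x y /=; apply: ler_of_sqr; first by rewrite addr_ge0.
rewrite sqr_sqrtr ?addr_ge0 ?sqr_ge0 // sqrrD !real_normK ?num_real //.
by rewrite addrAC lerDl mulrn_wge0 // mulr_ge0.
Qed.

Lemma series_coord p (u : nat -> E) n :
  coord p (series u n) = series (fun k => coord p (u k)) n.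
Proof.
rewrite /series /=; apply: (big_ind2 (fun X x => coord p X = x)) => //.
- exact: (rlinear0 (@coord_rlinear R N p)).
- by move=> X x Y y <- <-; rewrite -[X]scale1r coord_rlinear mul1r scale1r.
Qed.

Lemma coord_cbase p (a : ('I_N * 'I_N * bool)%type -> R) :
  coord p (\sum_q (a q)%:C *: mbase R q) = a p.
Proof.
rewrite (rlinear_sum _ _ (@coord_rlinear R N p)) (bigD1 p) //= big1 ?addr0 => [|q qp].
  case: p => [[i j] []]; rewrite /coord /mbase /= !mxE !eqxx mulr1 /= mulr1 //.
case: p q qp => [[i j] b] [[k l] b'] /=; rewrite /coord /mbase /= !mxE.
have [->|ki] := eqVneq i k; last first.
  by case: b; case: b'; rewrite /= !mulr0 ?(mul0r, mulr0, subr0, addr0).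
have [->|lj] := eqVneq j l; last first.
  by case: b; case: b'; rewrite /= !mulr0 ?(mul0r, mulr0, subr0, addr0).
by case: b; case: b'; rewrite ?eqxx //= => _; rewrite !(mulr0, mul0r, addr0, subr0).
Qed.

(** There are finitely many coordinates, so their convergence is uniform in the index and gives
    convergence of the matrices. Half of the radius goes to the real part of each entry and half to
    the imaginary part. *)
Lemma superexp_lim t (L : superop R N) X Z :
  (forall p, series (fun k => coord p ((t ^+ k / k`!%:R)%:C *: iter k L X)) @ \oo
     --> coord p Z) ->
  superexp t L X = Z.
Proof.
move=> h; rewrite /superexp.
pose v := series (fun k : nat => (t ^+ k / k`!%:R)%:C *: iter k L X).
have vlim l : v @ \oo --> l -> limn v = l.
  by move=> vl; apply/cvg_lim; [exact: norm_hausdorff|exact: vl].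
apply: vlim.
apply/cvg_ballP => e e0.
have e0' : 0 < complex.Re e / 2 by move: e0; rewrite ltcE /= => /andP[_ ?]; rewrite divr_gt0.
have hn : \forall k \near \oo, forall p, `|coord p Z - coord p (v k)| < complex.Re e / 2.
  apply: filter_forall => p; have /cvgrPdist_lt /(_ _ e0') := h p.
  by apply: filterS => k; rewrite -series_coord.
near=> k; split => // i j.
have hk : forall p, `|coord p Z - coord p (v k)| < complex.Re e / 2 by near: k.
apply: normc_lt => //.
have := hk (i, j, false); have := hk (i, j, true).
rewrite /coord /= => h1 h2.
have ReB (z w : C) : complex.Re (z - w) = complex.Re z - complex.Re w.
  by case: z; case: w.
have ImB (z w : C) : complex.Im (z - w) = complex.Im z - complex.Im w.
  by case: z; case: w.
by rewrite ReB ImB (splitr (complex.Re e)) ltrD.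
Unshelve. all: by end_near. Qed.

Lemma cvg_fsum (I : finType) (F : I -> nat -> R) (l : I -> R) :
  (forall i, F i n @[n --> \oo] --> l i) -> \sum_i F i n @[n --> \oo] --> \sum_i l i.
Proof.
move=> h; elim: (index_enum I) => [|i s IH].
  by rewrite big_nil; under eq_fun do rewrite big_nil; exact: cvg_cst.
by rewrite big_cons; under eq_fun do rewrite big_cons; exact: cvgD.
Qed.

Lemma cvg_rlinear (f : E -> R) (u : nat -> E) Z : rlinear f ->
  (forall p, coord p (u n) @[n --> \oo] --> coord p Z) -> f (u n) @[n --> \oo] --> f Z.
Proof.
move=> fl h; rewrite (rlinear_coord Z fl).
rewrite (_ : (fun n => f (u n)) = fun n => \sum_p coord p (u n) * f (mbase R p)); last first.
  by apply/funext => n; rewrite (rlinear_coord _ fl).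
by apply: cvg_fsum => p; apply: cvgMr_tmp; exact: h.
Qed.

Section Taylor.
Variables (W : E) (L : superop R N) (K t : R).
Hypotheses (Wu : W \in unitmx) (K0 : 0 <= K) (t0 : 0 <= t).
Hypothesis LK : forall X, wnorm W (L X) <= K * wnorm W X.
Variable X : E.

Let term k : E := (t ^+ k / k`!%:R)%:C *: iter k L X.

Let wnorm_term k : wnorm W (term k) <= exp_coeff (t * K) k * wnorm W X.
Proof.
have h : wnorm W (iter k L X) <= K ^+ k * wnorm W X.
  elim: k => [|k IH]; first by rewrite expr0 mul1r.
  by rewrite iterS exprS -mulrA (le_trans (LK _)) // ler_wpM2l.
have c0 : 0 <= t ^+ k / k`!%:R by rewrite divr_ge0 // exprn_ge0.
have -> : exp_coeff (t * K) k * wnorm W X = t ^+ k / k`!%:R * (K ^+ k * wnorm W X).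
  by rewrite /exp_coeff /= exprMn; ring.
by rewrite /term wnormZ ger0_norm // ler_wpM2l.
Qed.

Let term_cvg p : cvgn (series (fun k => coord p (term k))).
Proof.
have [c c0 hc] := coord_le Wu p.
apply: normed_cvg.
apply: (@series_le_cvg _ _ (fun k => c * wnorm W X * exp_coeff (t * K) k)).
- by move=> n; rewrite normr_ge0.
- move=> n; apply: mulr_ge0; first by rewrite mulr_ge0 ?wnorm_ge0.
  by apply: exp_coeff_ge0; rewrite mulr_ge0.
- move=> n; rewrite (le_trans (hc _)) // -mulrA ler_wpM2l //.
  by rewrite mulrC wnorm_term.
- rewrite (_ : series _ = (c * wnorm W X) *: series (exp_coeff (t * K))).
    by apply: is_cvgZl_tmp; exact: is_cvg_series_exp_coeff.
  by apply/funext => n; rewrite /series /= -mulr_sumr.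
Qed.

Let Z : E := \sum_p (limn (series (fun k => coord p (term k))))%:C *: mbase R p.

Let Z_cvg p : coord p (series term n) @[n --> \oo] --> coord p Z.
Proof.
rewrite coord_cbase (_ : (fun n => _) = series (fun k => coord p (term k))).
  exact: term_cvg.
by apply/funext => n; rewrite series_coord.
Qed.

Let superexpE : superexp t L X = Z.
Proof.
apply: superexp_lim => p.
rewrite (_ : series _ = fun n => coord p (series term n)); first exact: Z_cvg.
by apply/funext => n; rewrite series_coord.
Qed.

(** Without its first two terms the series is dominated by x^2 times the exponential series at x = t
    K, because (k+2)! >= k!. *)
Lemma superexp_taylor :
  wnorm W (superexp t L X - X - t%:C *: L X) <=
    (t * K) ^+ 2 * expR (t * K) * wnorm W X.
Proof.
rewrite superexpE; set x := t * K; set B := x ^+ 2 * expR x * wnorm W X.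
have x0 : 0 <= x by rewrite mulr_ge0.
have hB n : wnorm W (series term n.+2 - X - t%:C *: L X) <= B.
  have -> : series term n.+2 - X - t%:C *: L X = \sum_(0 <= k < n) term k.+2.
    have e (P Q V : E) : P + (Q + V) - P - Q = V by rewrite [P + _]addrC addrK [Q + _]addrC addrK.
    have t0E : term 0 = X by rewrite /term /= expr0 fact0 divr1 scale1r.
    have t1E : term 1 = t%:C *: L X by rewrite /term /= expr1 divr1.
    by rewrite /series /= !big_nat_recl // t0E t1E e.
  apply: le_trans (wnorm_sum _ _ _ _) _.
  apply: (@le_trans _ _ (\sum_(0 <= k < n) x ^+ 2 * wnorm W X * exp_coeff x k)).
    apply: ler_sum => k _; apply: le_trans (wnorm_term _) _.
    rewrite [leRHS]mulrAC ler_wpM2r ?wnorm_ge0 // /exp_coeff /= -addn2 exprD mulrC.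
    rewrite [leRHS]mulrA [leRHS]mulrC [x ^+ 2 * _]mulrC ler_wpM2r ?mulr_ge0 ?exprn_ge0 //.
    by rewrite lef_pV2 ?posrE ?ltr0n ?fact_gt0 // ler_nat addn2 !factS !mulnA leq_pmull.
  rewrite -mulr_sumr (_ : B = x ^+ 2 * wnorm W X * expR x); last by rewrite /B mulrAC.
  rewrite ler_wpM2l ?mulr_ge0 ?sqr_ge0 ?wnorm_ge0 //.
  apply: (@nondecreasing_cvgn_le _ (series (exp_coeff x))).
    by apply: nondecreasing_series => k _ _; exact: exp_coeff_ge0.
  exact: is_cvg_series_exp_coeff.
set D := Z - X - t%:C *: L X.
have [->|D0] := eqVneq (wnorm W D) 0.
  by rewrite !mulr_ge0 ?sqr_ge0 ?wnorm_ge0 // expR_ge0.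
have Dp : 0 < wnorm W D by rewrite lt_neqAle eq_sym D0 wnorm_ge0.
rewrite -(ler_pM2l Dp) -expr2 sqr_wnorm {2}/D !wdotBr.
(* Pairing with the remainder [D] itself reduces the passage to the limit to the convergence of one
   real linear functional; a factor |D| then cancels. *)
have cv : wdot W D (series term n) @[n --> \oo] --> wdot W D Z.
  by apply: cvg_rlinear => //; exact: wdot_rlinear.
rewrite -addrA -lerBrDr.
(* [hB] speaks of partial sums with at least two terms. *)
apply: (cvgr_to_le cv); exists 2 => // -[|[|n]] //= _.
rewrite lerBrDr addrA -!wdotBr; apply: le_trans (wdot_le _ _ _) _.
by rewrite ler_wpM2l ?wnorm_ge0.
Qed.

End Taylor.
End ExponentialSeries.

(** * Integration of bounded measurable functions and independence *)

(** This class is stable under sums, products and composition with random variables, and its members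
    are integrable for every probability, so integrability never has to be argued case by case. *)
Definition bmeasurable (R : realType) d (T : measurableType d) (f : T -> R) : Prop :=
  measurable_fun setT f /\ exists K, forall x, `|f x| <= K.

Section BoundedMeasurable.
Context (R : realType) d (T : measurableType d).
Implicit Types (f g : T -> R) (c : R).

Lemma bmeasurable_cst c : bmeasurable (fun _ : T => c).
Proof. by split; [exact: measurable_cst|exists `|c|]. Qed.

Lemma bmeasurableD f g :
  bmeasurable f -> bmeasurable g -> bmeasurable (fun x => f x + g x).
Proof.
move=> [mf [K hK]] [mg [J hJ]]; split; first exact: measurable_funD.
by exists (K + J) => x; rewrite (le_trans (ler_normD _ _)) // lerD.
Qed.

Lemma bmeasurableM f g :
  bmeasurable f -> bmeasurable g -> bmeasurable (fun x => f x * g x).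
Proof.
move=> [mf [K hK]] [mg [J hJ]]; split; first exact: measurable_funM.
by exists (K * J) => x; rewrite normrM ler_pM.
Qed.

Lemma bmeasurableZ c f : bmeasurable f -> bmeasurable (fun x => c * f x).
Proof. by move=> bf; apply: bmeasurableM => //; exact: bmeasurable_cst. Qed.

Lemma bmeasurable_sum (I : Type) (s : seq I) (F : I -> T -> R) :
  (forall i, bmeasurable (F i)) -> bmeasurable (fun x => \sum_(i <- s) F i x).
Proof.
move=> bF; elim: s => [|i s IH].
  by under [X in bmeasurable X]eq_fun do rewrite big_nil; exact: bmeasurable_cst.
by under [X in bmeasurable X]eq_fun do rewrite big_cons; exact: bmeasurableD.
Qed.

Lemma bmeasurable_prod (I : Type) (s : seq I) (P : pred I) (F : I -> T -> R) :
  (forall i, bmeasurable (F i)) -> bmeasurable (fun x => \prod_(i <- s | P i) F i x).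
Proof.
move=> bF; elim: s => [|i s IH].
  by under [X in bmeasurable X]eq_fun do rewrite big_nil; exact: bmeasurable_cst.
under [X in bmeasurable X]eq_fun do rewrite big_cons.
by case: (P i) => //; exact: bmeasurableM.
Qed.

Lemma bmeasurable_indic (B : set T) : measurable B -> bmeasurable (\1_B : T -> R).
Proof.
move=> mB; split; first exact: measurable_indic.
by exists 1 => x; rewrite indicE; case: (_ \in _); rewrite ?normr1 ?normr0.
Qed.

Lemma bmeasurable_comp d' (T' : measurableType d') (X : T' -> T) f :
  measurable_fun setT X -> bmeasurable f -> bmeasurable (fun x => f (X x)).
Proof.
move=> mX [mf [K hK]]; split; last by exists K => x.
exact: (measurableT_comp mf mX).
Qed.

Variable mu : probability T R.

Lemma bmeasurable_integrable f : bmeasurable f -> mu.-integrable setT (EFin \o f).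
Proof.
move=> [mf [K hK]]; apply: measurable_bounded_integrable => //.
  exact: le_lt_trans (probability_le1 mu measurableT) (ltry 1).
exists K; split; first exact: num_real.
by move=> x Kx y _ /=; rewrite (le_trans (hK y)) // ltW.
Qed.

Lemma bintegralD f g : bmeasurable f -> bmeasurable g ->
  \int[mu]_x (f x + g x) = \int[mu]_x f x + \int[mu]_x g x.
Proof. by move=> bf bg; rewrite RintegralD //; exact: bmeasurable_integrable. Qed.

Lemma bintegralZ c f : bmeasurable f -> \int[mu]_x (c * f x) = c * \int[mu]_x f x.
Proof. by move=> bf; rewrite RintegralZl //; exact: bmeasurable_integrable. Qed.

Lemma bintegral_cst c : \int[mu]_x c = c.
Proof.
rewrite Rintegral_cst // [X in fine X](_ : _ = 1%E) ?mulr1 //.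
exact: probability_setT.
Qed.

Lemma bintegral_sum (I : Type) (s : seq I) (F : I -> T -> R) :
  (forall i, bmeasurable (F i)) ->
  \int[mu]_x (\sum_(i <- s) F i x) = \sum_(i <- s) \int[mu]_x F i x.
Proof.
move=> bF; elim: s => [|i s IH].
  by rewrite big_nil; under eq_Rintegral do rewrite big_nil; rewrite bintegral_cst.
rewrite big_cons; under eq_Rintegral do rewrite big_cons.
by rewrite bintegralD // ?IH //; exact: bmeasurable_sum.
Qed.

Lemma le_bintegral f g : bmeasurable f -> bmeasurable g -> (forall x, f x <= g x) ->
  \int[mu]_x f x <= \int[mu]_x g x.
Proof.
by move=> bf bg fg; rewrite le_Rintegral // ?bmeasurable_integrable.
Qed.

Lemma le_norm_bintegral f c : bmeasurable f -> (forall x, `|f x| <= c) ->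
  `|\int[mu]_x f x| <= c.
Proof.
move=> bf fc; rewrite ler_norml; apply/andP; split.
  rewrite -(bintegral_cst (- c)); apply: le_bintegral => //; first exact: bmeasurable_cst.
  by move=> x; have := fc x; rewrite ler_norml => /andP[].
rewrite -[leRHS](bintegral_cst c); apply: le_bintegral => //; first exact: bmeasurable_cst.
by move=> x; have := fc x; rewrite ler_norml => /andP[].
Qed.

Lemma bintegral_indic (B : set T) : measurable B -> \int[mu]_x \1_B x = fine (mu B).
Proof. by move=> mB; rewrite /Rintegral integral_indic // setIT. Qed.

Lemma expectation_bintegral f : bmeasurable f -> ('E_mu[f] = (\int[mu]_x f x)%:E)%E.
Proof.
move=> bf; rewrite unlock fineK //.
by apply: integrable_fin_num => //; exact: bmeasurable_integrable.
Qed.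

End BoundedMeasurable.

(** * Independence as a product rule for integrals *)

Section IndependentFactor.
Context (R : realType) d d' (Omega : measurableType d) (A : measurableType d').
Variables (P : probability Omega R) (mu : probability A R) (X : Omega -> A).
Variables (G : Omega -> R) (c : R).
Hypotheses (mX : measurable_fun setT X) (bG : bmeasurable G).
Hypothesis XG : forall B, measurable B ->
  \int[P]_w (\1_B (X w) * G w) = (\int[mu]_x \1_B x) * c.

(** The sum counts the positive integers below [y], so it is the integer part of [y]. The induction
    removes the first level and shifts [y] by 1. *)
Lemma layer_cake_floor L (y : R) : 0 <= y < L%:R ->
  `|\sum_(k < L) ((k.+1%:R <= y)%R : nat)%:R - y| <= 1.
Proof.
elim: L y => [|L IH] y /andP[y0 yL]; first by move: (le_lt_trans y0 yL); rewrite ltxx.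
rewrite big_ord_recl /=; have [y1|y1] := lerP 1 y.
  have := IH (y - 1); rewrite subr_ge0 y1 ltrBlDr natr1 yL => /(_ isT).
  rewrite (_ : \sum_(k < L) _ - _ = 1 + \sum_(k < L) ((k.+2%:R <= y)%R : nat)%:R - y) //.
  rewrite opprB addrCA addrA; congr (_ + _ - _); apply: eq_bigr => k _.
  by rewrite lerBrDr natr1.
rewrite add0r big1 ?sub0r ?normrN ?ger0_norm ?(ltW y1) // => k _.
by rewrite leNgt (lt_le_trans y1) // ler1n.
Qed.

(* After scaling, [f] is within 1 of a sum of indicators of its superlevel sets,
   on which the identity is the hypothesis [XG]. *)
Lemma integral_indep_factor f : bmeasurable f ->
  \int[P]_w (f (X w) * G w) = (\int[mu]_x f x) * c.
Proof.
(* The defect of the product rule: it is linear, vanishes on indicators, and is at most [J + |c|]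
   times the sup norm. *)
pose H f := \int[P]_w (f (X w) * G w) - (\int[mu]_x f x) * c.
have bfG h : bmeasurable h -> bmeasurable (fun w => h (X w) * G w).
  by move=> bh; apply: bmeasurableM => //; exact: (bmeasurable_comp mX bh).
have HD h k : bmeasurable h -> bmeasurable k -> H (fun x => h x + k x) = H h + H k.
  move=> bh bk; rewrite /H (bintegralD mu bh bk).
  under eq_Rintegral do rewrite mulrDl.
  by rewrite (bintegralD P (bfG _ bh) (bfG _ bk)); ring.
have HZ a h : bmeasurable h -> H (fun x => a * h x) = a * H h.
  move=> bh; rewrite /H (bintegralZ mu a bh).
  under eq_Rintegral do rewrite -mulrA.
  by rewrite (bintegralZ P a (bfG _ bh)); ring.
have HI B : measurable B -> H \1_B = 0 by move=> mB; rewrite /H XG // subrr.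
have H1 : H (fun=> 1) = 0.
  by rewrite -(HI setT measurableT); congr H; apply/funext => x; rewrite indicE in_setT.
have HS (s : seq nat) (B : nat -> set A) : (forall k, measurable (B k)) ->
    H (fun x => \sum_(k <- s) \1_(B k) x) = 0.
  move=> mB; elim: s => [|k s IH].
    rewrite (_ : (fun _ => _) = (fun=> 0 * 1)).
      by rewrite (HZ 0 (fun=> 1)) ?mul0r //; exact: bmeasurable_cst.
    by apply/funext => x; rewrite big_nil mul0r.
  rewrite (_ : (fun _ => _) = fun x => \1_(B k) x + \sum_(j <- s) \1_(B j) x).
    rewrite HD ?HI ?IH ?addr0 //; first exact: bmeasurable_indic.
    by apply: bmeasurable_sum => j; exact: bmeasurable_indic.
  by apply/funext => x; rewrite big_cons.
have [_ [J hJ]] := bG.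
have Hle h e : bmeasurable h -> (forall x, `|h x| <= e) -> `|H h| <= e * (J + `|c|).
  move=> bh he; rewrite /H mulrDr (le_trans (ler_normB _ _)) // lerD //.
    apply: le_norm_bintegral; first exact: bfG.
    by move=> w; rewrite normrM ler_pM.
  by rewrite normrM ler_wpM2r // le_norm_bintegral.
move=> bf; apply/eqP; rewrite -subr_eq0 -/(H f) -normr_le0.
have [mf [K hK]] := bf.
have J0 : 0 <= J + `|c|.
  (* [J] bounds [G] only at points, so its sign requires a point; [Omega] has one because its
     probability is 1. *)
  have [w _] : exists w : Omega, True.
    apply: contrapT => noW; have := @probability_setT _ _ _ P.
    rewrite (_ : setT = set0) ?measure0; last first.
      by apply/seteqP; split => // w _; apply: noW; exists w.
    by move=> /eqP; rewrite eq_sym onee_eq0.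
  by rewrite addr_ge0 // (le_trans _ (hJ w)).
rewrite leNgt; apply/negP => Hf.
have [n nP] : exists n, (J + `|c|) / `|H f| < n%:R.
  by exists (Num.truncn ((J + `|c|) / `|H f|)).+1; rewrite truncnS_gt.
have n0 : 0 < n%:R :> R by rewrite (le_lt_trans _ nP) // divr_ge0.
(* The shift by [K] makes the values nonnegative, and dividing by [n] later shrinks the unit error
   of the layer-cake sum below what a nonzero [H f] allows. *)
pose y a := (f a + K) * n%:R.
pose L := (Num.truncn (2 * K * n%:R)).+1.
have yL a : 0 <= y a < L%:R.
  have := hK a; rewrite ler_norml => /andP[fl fu].
  rewrite mulr_ge0 ?(ltW n0) //=; last by lra.
  apply: le_lt_trans (truncnS_gt _); rewrite ler_pM2r //; lra.
pose B k := [set a | k.+1%:R <= y a].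
have mB k : measurable (B k).
  have my : measurable_fun setT y.
    by apply: measurable_funM => //; apply: measurable_funD.
  have := my measurableT _ (measurable_itv `[k.+1%:R, +oo[); rewrite setTI.
  by congr measurable; apply/seteqP; split => a /=; rewrite in_itv /= andbT.
pose S a := \sum_(k <- index_iota 0 L) \1_(B k) a : R.
have bS : bmeasurable S by apply: bmeasurable_sum => k; exact: bmeasurable_indic.
have Sy a : `|S a - y a| <= 1.
  have := layer_cake_floor (yL a); rewrite /S big_mkord; congr (`|_ - _| <= 1).
  apply: eq_bigr => k _; rewrite indicE; congr (nat_of_bool _)%:R.
  by apply/idP/idP; rewrite inE.
pose h a := - n%:R^-1 * S a + (f a + K * 1).
have b1 : bmeasurable (fun _ : A => 1 : R) by exact: bmeasurable_cst.
have bK := bmeasurableZ K b1.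
have bfK : bmeasurable (fun a => f a + K * 1) by exact: bmeasurableD.
have bh : bmeasurable h by apply: bmeasurableD => //; exact: bmeasurableZ.
have Hh : H h = H f.
  rewrite /h HD //; last exact: bmeasurableZ.
  by rewrite HZ // HS // mulr0 add0r HD // HZ // H1 mulr0 addr0.
have : `|H h| <= n%:R^-1 * (J + `|c|).
  apply: Hle => // a.
  have -> : h a = - n%:R^-1 * (S a - y a).
    by rewrite /h /y; field; rewrite gt_eqF.
  have ni : 0 <= n%:R^-1 :> R by rewrite invr_ge0 ltW.
  by rewrite normrM normrN (ger0_norm ni) ler_piMr.
rewrite Hh leNgt => /negP; apply.
by rewrite mulrC ltr_pdivrMr // mulrC -ltr_pdivrMr.
Qed.

End IndependentFactor.

Section IidProducts.
Context (R : realType) d d' (Omega : measurableType d) (A : measurableType d').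
Variables (P : probability Omega R) (mu : probability A R) (M : nat).
Variable a : 'I_M -> {RV P >-> A}.
Hypothesis iid : iid_samples mu a.
Implicit Types (f : 'I_M -> A -> R) (phi : Omega -> R) (v : A -> R).

Let bmeasurable_sample v k : bmeasurable v -> bmeasurable (fun w => v (a k w)).
Proof. by move=> bv; apply: (bmeasurable_comp _ bv); exact: measurable_funPT. Qed.

Lemma iid_prod_indic (B : 'I_M -> set A) : (forall k, measurable (B k)) ->
  \int[P]_w (\prod_k \1_(B k) (a k w)) = \prod_k \int[mu]_x \1_(B k) x.
Proof.
move=> mB; have [law ind] := iid.
set D := [set w | forall i, i \in [set: 'I_M]%SET -> B i (a i w)].
have DE : (fun w => \prod_k \1_(B k) (a k w)) = \1_D :> (Omega -> R).
  apply/funext => w; rewrite indicE; case: (boolP (w \in D)) => wD.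
    rewrite big1 // => k _; rewrite indicE mem_set //.
    by move: wD; rewrite inE => /(_ k); apply; rewrite finset.in_setT.
  have [k kB] : exists k, ~ B k (a k w).
    apply/existsNP => h; move/negP: wD; apply; rewrite inE => k _; exact: h.
  by rewrite (bigD1 k) //= indicE memNset // mul0r.
have mD : measurable D.
  apply/(@measurable_indicP _ _ R); rewrite -DE.
  by apply: (bmeasurable_prod _ _ _).1 => k; apply: bmeasurable_sample; exact: bmeasurable_indic.
rewrite DE bintegral_indic // ind // (_ : (\prod_(i in _) _)%E = (\prod_k fine (mu (B k)))%:E).
  by rewrite /=; apply: eq_bigr => k _; rewrite bintegral_indic.
rewrite -prodEFin; apply: eq_big => [k|k _]; first by rewrite finset.in_setT.
by rewrite fineK ?fin_num_measure // -(law k).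
Qed.

(** Indicators are replaced by bounded functions one index at a time: in [Q], the functions of index
    at least [m] are still indicators. *)
Lemma iid_prod f : (forall k, bmeasurable (f k)) ->
  \int[P]_w (\prod_k f k (a k w)) = \prod_k \int[mu]_x f k x.
Proof.
suff Q m g : (forall k, bmeasurable (g k)) ->
    (forall k : 'I_M, (m <= k)%N -> exists2 B, measurable B & g k = \1_B) ->
    \int[P]_w (\prod_k g k (a k w)) = \prod_k \int[mu]_x g k x.
  by move=> bf; apply: (Q M) => // k; rewrite leqNgt ltn_ord.
elim: m g => [|m IH] g bg hg.
  (* The set is recovered from its indicator, which gives the whole family without a choice for each
     [k]. *)
  pose B k := g k @^-1` [set 1].
  have gB k : measurable (B k) /\ g k = \1_(B k).
    have [B0 mB0 gE] := hg k isT.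
    suff -> : B k = B0 by [].
    apply/seteqP; split => x; rewrite /B /= gE indicE.
      by case: (boolP (x \in B0)) => [|_ /esym/eqP]; [rewrite inE|rewrite oner_eq0].
    by move=> xB; rewrite mem_set.
  under eq_Rintegral do under eq_bigr do rewrite (gB _).2.
  rewrite iid_prod_indic => [|k]; last exact: (gB k).1.
  by apply: eq_bigr => k _; rewrite -(gB k).2.
have [mM|Mm] := ltnP m M; last first.
  by apply: IH => // k mk; move: (ltn_ord k); rewrite ltnNge (leq_trans Mm).
pose k0 := Ordinal mM.
rewrite (bigD1 k0) //=; under eq_Rintegral do rewrite (bigD1 k0) //=.
apply: integral_indep_factor; [exact: measurable_funPT| |  |exact: bg].
  by apply: bmeasurable_prod => k; exact: bmeasurable_sample.
(* The remaining hypothesis of [integral_indep_factor] is the induction hypothesis with an indicator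
   put back at index [m]. *)
move=> B mB; pose g' k := if k == k0 then \1_B else g k.
have g'0 : g' k0 = \1_B by rewrite /g' eqxx.
have g'n k : k != k0 -> g' k = g k by rewrite /g' => /negPf ->.
have bg' k : bmeasurable (g' k).
  by rewrite /g'; case: eqP => // _; exact: bmeasurable_indic.
have hg' (k : 'I_M) : (m <= k)%N -> exists2 B, measurable B & g' k = \1_B.
  move=> mk; rewrite /g'; case: eqP => [_|kk0]; first by exists B.
  apply: hg; rewrite ltn_neqAle mk andbT; apply/eqP => mkE; apply: kk0.
  exact/val_inj.
clearbody g'; have := IH g' bg' hg'; rewrite [RHS](bigD1 k0) //= g'0.
rewrite [X in _ = _ * X](_ : _ = \prod_(i < M | i != k0) \int[mu]_x g i x); last first.
  by apply: eq_bigr => k /g'n ->.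
move=> <-; apply: eq_Rintegral => w _; rewrite [RHS](bigD1 k0) //= g'0; congr (_ * _).
by apply: eq_bigr => k /g'n ->.
Qed.

(* [phi] is independent of the samples of index at least [m], in the form of a
   product rule: the test functions [f k] are trivial for [k < m]. *)
Definition indep_future (m : nat) phi : Prop := bmeasurable phi /\
  forall f, (forall k, bmeasurable (f k)) ->
    (forall k : 'I_M, (k < m)%N -> f k = fun=> 1) ->
    \int[P]_w (phi w * \prod_k f k (a k w)) = (\int[P]_w phi w) * \prod_k \int[mu]_x f k x.

Lemma indep_future_cst c : indep_future 0 (fun=> c).
Proof.
split=> [|f bf _]; first exact: bmeasurable_cst.
rewrite bintegralZ; last by apply: bmeasurable_prod => k; exact: bmeasurable_sample.
by rewrite iid_prod // bintegral_cst.
Qed.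

Lemma indep_future_sum m (I : Type) (s : seq I) (phi : I -> Omega -> R) :
  (forall i, indep_future m (phi i)) -> indep_future m (fun w => \sum_(i <- s) phi i w).
Proof.
move=> h; split=> [|f bf f1]; first by apply: bmeasurable_sum => i; exact: (h i).1.
rewrite bintegral_sum => [|i]; last exact: (h i).1.
rewrite mulr_suml; under eq_Rintegral do rewrite mulr_suml.
rewrite bintegral_sum => [|i].
  by apply: eq_bigr => i _; exact: (h i).2.
apply: bmeasurableM; first exact: (h i).1.
by apply: bmeasurable_prod => k; exact: bmeasurable_sample.
Qed.

(** The new factor is itself a test function: [v] goes into slot [m], which the test functions
    allowed at time [m.+1] leave equal to 1. Taking all of those equal to 1 gives the first
    claim. *)
Lemma indep_future_step (m : 'I_M) phi v : indep_future m phi -> bmeasurable v ->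
  \int[P]_w (phi w * v (a m w)) = (\int[P]_w phi w) * \int[mu]_x v x
  /\ indep_future m.+1 (fun w => phi w * v (a m w)).
Proof.
move=> [bphi hphi] bv.
have key f : (forall k, bmeasurable (f k)) ->
    (forall k : 'I_M, (k < m.+1)%N -> f k = fun=> 1) ->
    \int[P]_w (phi w * v (a m w) * \prod_k f k (a k w)) =
    (\int[P]_w phi w) * (\int[mu]_x v x) * \prod_k \int[mu]_x f k x.
  move=> bf f1; pose f' k := if k == m then v else f k.
  have f'n k : k != m -> f' k = f k by rewrite /f' => /negPf ->.
  have f'0 : f' m = v by rewrite /f' eqxx.
  have bf' k : bmeasurable (f' k) by rewrite /f'; case: eqP.
  have hf' (k : 'I_M) : (k < m)%N -> f' k = fun=> 1.
    move=> km; rewrite f'n; first by apply: f1; exact: leqW.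
    by apply/eqP => kE; move: km; rewrite kE ltnn.
  clearbody f'; have := hphi f' bf' hf'; rewrite [X in _ = _ * X](bigD1 m) //= f'0.
  rewrite [X in _ = _ * (_ * X)](_ : _ = \prod_k \int[mu]_x f k x); last first.
    rewrite [RHS](bigD1 m) //= f1 // bintegral_cst mul1r.
    by apply: eq_bigr => k /f'n ->.
  rewrite mulrA => <-; apply: eq_Rintegral => w _; rewrite -mulrA; congr (_ * _).
  rewrite [RHS](bigD1 m) //= f'0; congr (_ * _).
  by rewrite (bigD1 m) //= f1 // mul1r; apply: eq_bigr => k /f'n ->.
have step : \int[P]_w (phi w * v (a m w)) = (\int[P]_w phi w) * \int[mu]_x v x.
  have := key (fun _ _ => 1) (fun=> bmeasurable_cst _ 1) (fun _ _ => erefl).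
  under eq_Rintegral do rewrite big1 ?mulr1 //.
  by move=> ->; rewrite big1 ?mulr1 // => k _; rewrite bintegral_cst.
split=> //; split; first by apply: bmeasurableM => //; exact: bmeasurable_sample.
by move=> f bf f1; rewrite key // step.
Qed.

End IidProducts.

(** * Channels, states and mean superoperators *)

Section States.
Variables (R : realType) (N : nat).
Local Notation C := R[i].
Local Notation E := 'M[R[i]]_N.
Implicit Types (X Y Z rho : E).

Lemma dag_mxblock1 X :
  (\mxblock_(i < 1, j < 1) X)^t* = \mxblock_(i < 1, j < 1) (X^t*).
Proof. by apply/matrixP => i j; rewrite !mxE. Qed.

Lemma quad_mxblock1 X (v : forall i : 'I_1, 'cV[C]_N) :
  (\mxcol_i v i)^t* *m (\mxblock_(i < 1, j < 1) X) *m (\mxcol_i v i) =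
  (v ord0)^t* *m X *m v ord0.
Proof.
have -> : (\mxcol_i v i)^t* = \mxrow_i (v i)^t* by apply/matrixP => i j; rewrite !mxE.
rewrite mul_mxrow_mxblock mul_mxrow_mxcol.
by rewrite big_ord1 big_ord1.
Qed.

(** Through this, complete positivity with a single block is positivity. *)
Lemma psd_mxblock1 X : is_psd (\mxblock_(i < 1, j < 1) X) <-> is_psd X.
Proof.
split=> -[/hermsymmxP hX pX]; split.
- apply/hermsymmxP; move: hX; rewrite dag_mxblock1 => /eq_mxblockP /(_ ord0 ord0).
  by [].
- by move=> v; rewrite -(quad_mxblock1 X (fun=> v)).
- by apply/hermsymmxP; rewrite dag_mxblock1 hX.
- by move=> v; rewrite -(submxcolK v) quad_mxblock1.
Qed.

Lemma channel_state (Phi : superop R N) rho :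
  is_channel Phi -> is_state rho -> is_state (Phi rho).
Proof.
move=> [_ cp tp] [p t1]; split; last by rewrite tp.
by apply/psd_mxblock1; apply: (cp 1 (fun _ _ => rho)); apply/psd_mxblock1.
Qed.

Lemma psd_rank1 (w : 'cV[C]_N) : is_psd (w *m w^t*).
Proof.
split; first by apply/hermsymmxP; rewrite dagM dagK.
move=> v; rewrite mulmxA -mulmxA.
have -> : v^t* *m w = (w^t* *m v)^t* by rewrite dagM dagK.
rewrite mxE big_ord1 mxE mxE mulrC; exact: mulcJ_ge0.
Qed.

Lemma psdZ (c : R) X : 0 <= c -> is_psd X -> is_psd (c%:C *: X).
Proof.
move=> c0 [/hermsymmxP hX pX]; split.
  by apply/hermsymmxP; rewrite dagZ hX; congr (_ *: _); exact: conjRC.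
by move=> v; rewrite -scalemxAr -scalemxAl mxE mulr_ge0 // ler0c.
Qed.

Lemma trace_rank1 (w : 'cV[C]_N) : \tr (w *m w^t*) = (vec_norm w ^+ 2)%:C.
Proof.
rewrite mxtrace_mulC /mxtrace big_ord1.
have := sqr_vecE w; rewrite -sqr_vec_norm => <-.
have : 0 <= (w^t* *m w) 0 0.
  rewrite mxE; apply: sumr_ge0 => i _; rewrite !mxE mulrC; exact: mulcJ_ge0.
by move=> h; rewrite RRe_real // ger0_real.
Qed.

Section Span.
Variable Q : E -> Prop.
Hypotheses (Q0 : Q 0) (Qlin : forall (c : C) X Y, Q X -> Q Y -> Q (c *: X + Y)).
Hypothesis Qst : forall rho, is_state rho -> Q rho.

Let QZ c X : Q X -> Q (c *: X).
Proof. by move=> h; rewrite -[_ *: _]addr0; exact: Qlin. Qed.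

Let QD X Y : Q X -> Q Y -> Q (X + Y).
Proof. by move=> h h'; rewrite -[X]scale1r; exact: Qlin. Qed.

Let Q_rank1 (w : 'cV[C]_N) : Q (w *m w^t*).
Proof.
have [w0|w0] := eqVneq (vec_norm w) 0.
  by rewrite (vec_norm_eq0 w0) mul0mx.
have s0 : vec_norm w ^+ 2 != 0 by rewrite sqrf_eq0.
have -> : w *m w^t* = (vec_norm w ^+ 2)%:C *: ((vec_norm w ^+ 2)^-1%:C *: (w *m w^t*)).
  by rewrite scalerA -rmorphM divff // scale1r.
apply: QZ; apply: Qst; split.
  by apply: psdZ; [rewrite invr_ge0 sqr_ge0|exact: psd_rank1].
by rewrite mxtraceZ trace_rank1 -rmorphM mulVf.
Qed.

Let ii : ('i%C * 'i%C = -1 :> C).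
Proof. by rewrite -expr2 sqr_i. Qed.

(* Polarization by the rank one operators on [u], [v], [u + v] and [u + i v]. *)
Let Q_rank2 (u v : 'cV[C]_N) : Q (u *m v^t*).
Proof.
have e1 : (u + v) *m (u + v)^t* = u *m u^t* + u *m v^t* + (v *m u^t* + v *m v^t*).
  by rewrite dagD mulmxDl !mulmxDr.
have e2 : (u + 'i%C *: v) *m (u + 'i%C *: v)^t* =
   u *m u^t* - 'i%C *: (u *m v^t*) + ('i%C *: (v *m u^t*) + v *m v^t*).
  have ci : ('i%C : C)^* = - 'i%C by apply/eqP; rewrite eq_complex /= oppr0 !eqxx.
  have civ : ('i%C *: v)^t* = - 'i%C *: v^t* by rewrite dagZ; congr (_ *: _).
  rewrite dagD civ mulmxDl !mulmxDr -!scalemxAl -!scalemxAr scalerA.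
  by rewrite mulrN ii opprK scale1r scaleNr.
have q1 : Q (u *m v^t* + v *m u^t*).
  have -> : u *m v^t* + v *m u^t* =
      (u + v) *m (u + v)^t* + ((-1) *: (u *m u^t*) + (-1) *: (v *m v^t*)).
    rewrite e1 !scaleN1r; move: (u *m u^t*) (u *m v^t*) (v *m u^t*) (v *m v^t*) => a b c d.
    by rewrite addrACA [a + b]addrC addrK addrK.
  by do 2?apply: QD; try apply: QZ; apply: Q_rank1.
have q2 : Q ('i%C *: (v *m u^t*) - 'i%C *: (u *m v^t*)).
  have -> : 'i%C *: (v *m u^t*) - 'i%C *: (u *m v^t*) =
      (u + 'i%C *: v) *m (u + 'i%C *: v)^t* + ((-1) *: (u *m u^t*) + (-1) *: (v *m v^t*)).
    rewrite e2 !scaleN1r.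
    move: (u *m u^t*) ('i%C *: (u *m v^t*)) ('i%C *: (v *m u^t*)) (v *m v^t*) => a b c d.
    by rewrite addrACA [a - b]addrC addrK addrK addrC.
  by do 2?apply: QD; try apply: QZ; apply: Q_rank1.
have -> : u *m v^t* = 2^-1 *: ((u *m v^t* + v *m u^t*) +
    'i%C *: ('i%C *: (v *m u^t*) - 'i%C *: (u *m v^t*))).
  rewrite scalerBr !scalerA ii !scaleN1r opprK.
  move: (u *m v^t*) (v *m u^t*) => a b.
  rewrite [- b + a]addrC addrACA subrr addr0 -mulr2n -[a *+ 2]scaler_nat scalerA.
  by rewrite mulVf ?scale1r // pnatr_eq0.
by apply: QZ; apply: QD => //; apply: QZ.
Qed.

(** Normalized rank one operators are states, and by polarization they span the matrix units. It
    extends to all matrices what is assumed on states only. *)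
Lemma state_span X : Q X.
Proof.
rewrite [X]matrix_sum_delta.
apply: big_ind => // i _; apply: big_ind => // j _; apply: QZ.
have -> : delta_mx i j = (delta_mx i 0 : 'cV[C]_N) *m (delta_mx j 0 : 'cV[C]_N)^t*.
  by rewrite trmx_delta map_delta_mx mul_delta_mx.
exact: Q_rank2.
Qed.

End Span.
End States.

(** * Averages of superoperators *)

Section MeanSuperop.
Context (R : realType) (N : nat) d (A : measurableType d).
Variable mu : probability A R.
Local Notation C := R[i].
Local Notation E := 'M[R[i]]_N.
Implicit Types (X Y Z W : E) (g h : A -> E) (G : A -> superop R N) (f : E -> R).

Definition bmatrix g : Prop := forall p, bmeasurable (fun a => coord p (g a)).

Lemma coord_inj X Y : (forall p, coord p X = coord p Y) -> X = Y.
Proof.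
by move=> XY; rewrite (coord_base X) (coord_base Y); apply: eq_bigr => p _; rewrite XY.
Qed.

Lemma bmatrix_cst X : bmatrix (fun=> X).
Proof. by move=> p; exact: bmeasurable_cst. Qed.

Lemma bmatrix_lin (c : R) g h : bmatrix g -> bmatrix h -> bmatrix (fun a => c%:C *: g a + h a).
Proof.
move=> bg bh p; under eq_fun do rewrite coord_rlinear.
by apply: bmeasurableD => //; exact: bmeasurableZ.
Qed.

Lemma bmatrixB g h : bmatrix g -> bmatrix h -> bmatrix (fun a => g a - h a).
Proof.
move=> bg bh; rewrite (_ : (fun _ => _) = fun a => (-1)%:C *: h a + g a).
  exact: bmatrix_lin.
by apply/funext => a; rewrite rmorphN1 scaleN1r addrC.
Qed.

Lemma bmatrix_rlinear f g : rlinear f -> bmatrix g -> bmeasurable (fun a => f (g a)).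
Proof.
move=> fl bg; under [X in bmeasurable X]eq_fun do rewrite (rlinear_coord _ fl).
by apply: bmeasurable_sum => p; apply: bmeasurableM => //; exact: bmeasurable_cst.
Qed.

Lemma bmatrix_wdot W g h : bmatrix g -> bmatrix h -> bmeasurable (fun a => wdot W (g a) (h a)).
Proof.
move=> bg bh; under [X in bmeasurable X]eq_fun do rewrite wdot_coord.
apply: bmeasurable_sum => p; apply: bmeasurable_sum => q.
by apply: bmeasurableM; [exact: bmeasurableM|exact: bmeasurable_cst].
Qed.

Lemma bmatrix_bounded W G X K : W \in unitmx -> measurable_superop G ->
  (forall a, wnorm W (G a X) <= K) -> bmatrix (fun a => G a X).
Proof.
move=> Wu mG GK p; split.
  by case: p => -[i j] [] /=; rewrite /coord /=; case: (mG X i j).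
have [c c0 hc] := coord_le Wu p; exists (c * K) => a.
by rewrite (le_trans (hc _)) // ler_wpM2l.
Qed.

Lemma coord_mean G X p : coord p (mean_superop mu G X) = \int[mu]_a coord p (G a X).
Proof. by case: p => -[i j] []; rewrite /coord /= /mean_superop mxE. Qed.

(** A real linear functional is a finite combination of coordinates, so it commutes with the mean.
    Trace, positivity and norm bounds of the mean are obtained by choosing the functional. *)
Lemma rlinear_mean f G X : rlinear f -> bmatrix (fun a => G a X) ->
  f (mean_superop mu G X) = \int[mu]_a f (G a X).
Proof.
move=> fl bG; rewrite (rlinear_coord _ fl).
under [RHS]eq_Rintegral do rewrite (rlinear_coord _ fl).
rewrite bintegral_sum => [|p]; last first.
  by apply: bmeasurableM => //; exact: bmeasurable_cst.
apply: eq_bigr => p _; rewrite coord_mean mulrC -bintegralZ //.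
by apply: eq_Rintegral => a _; rewrite mulrC.
Qed.

Lemma mean_superop_rlin G (c : R) X Y : (forall X, bmatrix (fun a => G a X)) ->
  (forall a, G a (c%:C *: X + Y) = c%:C *: G a X + G a Y) ->
  mean_superop mu G (c%:C *: X + Y) = c%:C *: mean_superop mu G X + mean_superop mu G Y.
Proof.
move=> bG lG; apply: coord_inj => p; rewrite coord_rlinear !coord_mean.
under eq_Rintegral do rewrite lG coord_rlinear.
by rewrite (bintegralD mu (bmeasurableZ c (bG X p)) (bG Y p)) (bintegralZ mu c (bG X p)).
Qed.

Lemma Re_trace_rlinear : rlinear (fun X => complex.Re (\tr X)).
Proof. by move=> c X Y; rewrite mxtraceD mxtraceZ ReD ReM_real. Qed.

Lemma Im_trace_rlinear : rlinear (fun X => complex.Im (\tr X)).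
Proof. by move=> c X Y; rewrite mxtraceD mxtraceZ ImD ImM_real. Qed.

Lemma mean_superop_trace G X z : bmatrix (fun a => G a X) ->
  (forall a, \tr (G a X) = z) -> \tr (mean_superop mu G X) = z.
Proof.
move=> bG tG; apply/eqP; rewrite eq_complex.
rewrite (rlinear_mean Re_trace_rlinear bG) (rlinear_mean Im_trace_rlinear bG).
under eq_Rintegral do rewrite tG; under [in X in _ && X]eq_Rintegral do rewrite tG.
by rewrite !bintegral_cst !eqxx.
Qed.

Lemma mean_superop_state G X : bmatrix (fun a => G a X) ->
  (forall a, is_state (G a X)) -> is_state (mean_superop mu G X).
Proof.
move=> bG sG; split; last by apply: mean_superop_trace => // a; exact: (sG a).2.
have quadD (v : 'cV[C]_N) (c : R) Y Z : (v^t* *m (c%:C *: Y + Z) *m v) 0 0 =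
    c%:C * (v^t* *m Y *m v) 0 0 + (v^t* *m Z *m v) 0 0.
  by rewrite mulmxDr mulmxDl -scalemxAr -scalemxAl 2!mxE.
split.
  apply/hermsymmxP; apply: coord_inj => p.
  have fl : rlinear (fun X => coord p (X^t*) - coord p X).
    move=> c Y Z; have cc : (c%:C *: Y)^t* = c%:C *: Y^t*.
      by rewrite dagZ; congr (_ *: _); exact: conjRC.
    by rewrite dagD cc !coord_rlinear; ring.
  apply/eqP; rewrite -subr_eq0 (rlinear_mean fl bG).
  under eq_Rintegral do rewrite ((hermsymmxP _).1 (sG _).1.1) subrr.
  by rewrite bintegral_cst.
move=> v.
have rl : rlinear (fun X => complex.Re ((v^t* *m X *m v) 0 0)).
  by move=> c Y Z; rewrite quadD ReD ReM_real.
have il : rlinear (fun X => complex.Im ((v^t* *m X *m v) 0 0)).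
  by move=> c Y Z; rewrite quadD ImD ImM_real.
have v0 a : 0 <= complex.Re ((v^t* *m G a X *m v) 0 0) /\
    complex.Im ((v^t* *m G a X *m v) 0 0) = 0.
  by have := (sG a).1.2 v; rewrite lecE => /andP[/eqP].
rewrite lecE (rlinear_mean rl bG) (rlinear_mean il bG).
under eq_Rintegral do rewrite (v0 _).2.
rewrite bintegral_cst eqxx /=; apply: Rintegral_ge0 => a _.
exact: (v0 a).1.
Qed.

End MeanSuperop.

(** * One step of the average and of the random dynamics *)

Section Recursion.
Variable R : realType.
Implicit Types (x : nat -> R) (h k b c z t : R).

(** Since exp (t + c) >= 1, the left side is at most exp t (1 + z exp c). This absorbs an additive
    error into the exponent. *)
Lemma expR_add_le t z c : - c <= t -> 0 <= z -> expR t + z <= expR (t + z * expR c).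
Proof.
move=> ct z0; rewrite expRD.
apply: le_trans (_ : expR t * (1 + z * expR c) <= _); last first.
  by rewrite ler_wpM2l ?expR_ge0 // expR_ge1Dx.
rewrite mulrDr mulr1 lerD2l mulrCA ler_peMr // -expRD -expR0 ler_expR; lra.
Qed.

(* [s = exp c / h] satisfies [exp (- h) * s + 1 <= s], so that [exp (m k) * b * s]
   dominates the accumulated increments. *)
Lemma geometric_recursion x h k b c (M : nat) :
  0 < h -> h <= c -> 0 <= k -> 0 <= b ->
  (forall m, (m < M)%N -> x m.+1 <= expR (- h + k) * x m + b) ->
  x M <= expR (k * M%:R) * (expR (- (h * M%:R)) * x 0%N + b * (expR c / h)).
Proof.
move=> h0 hc k0 b0 xS; set s := expR c / h.
have s0 : 0 <= s by rewrite divr_ge0 ?expR_ge0 ?ltW.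
have sP : expR (- h) * s + 1 <= s.
  (* Equivalent to 1 + h <= exp h. *)
  have e1 : h * expR (- h) <= 1 - expR (- h).
    have := expR_ge1Dx h; have := expR_gt0 (- h); have := expRxMexpNx_1 h.
    by move: (expR h) (expR (- h)) => u v uv v0 hu; nra.
  have e2 : 1 <= expR c * expR (- h) by rewrite -expRD -[leLHS]expR0 ler_expR subr_ge0.
  have : 1 <= s * (1 - expR (- h)).
    apply: le_trans e2 _; rewrite /s -mulrA ler_wpM2l ?expR_ge0 //.
    by rewrite mulrC ler_pdivlMr // mulrC.
  by lra.
suff Q m : (m <= M)%N ->
    x m <= expR (k * m%:R) * (expR (- (h * m%:R)) * x 0%N + b * s) by exact: Q.
elim: m => [|m IH] mM.
  by rewrite !mulr0 oppr0 expR0 !mul1r lerDl mulr_ge0.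
apply: le_trans (xS m mM) _.
apply: le_trans (_ : expR (- h + k) * (expR (k * m%:R) * (expR (- (h * m%:R)) * x 0%N + b * s)) + b <= _).
  by rewrite lerD2r ler_wpM2l ?expR_ge0 // IH // ltnW.
have -> : expR (k * m.+1%:R) = expR k * expR (k * m%:R).
  by rewrite -expRD -natr1 mulrDr mulr1 addrC.
have -> : expR (- (h * m.+1%:R)) = expR (- h) * expR (- (h * m%:R)).
  by rewrite -expRD -natr1; congr expR; ring.
rewrite expRD.
(* The accumulated factor is at least 1, so the fresh increment [b] may be multiplied by it and then
   absorbed by [sP]. *)
have g1 : 1 <= expR k * expR (k * m%:R).
  by rewrite -expRD -[leLHS]expR0 ler_expR addr_ge0 // mulr_ge0.
have -> : expR (- h) * expR k * (expR (k * m%:R) * (expR (- (h * m%:R)) * x 0%N + b * s)) + b =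
  expR k * expR (k * m%:R) * (expR (- h) * expR (- (h * m%:R)) * x 0%N + b * (expR (- h) * s)) + b
  by ring.
move: (expR k * _) g1 (expR (- h) * expR _ * _) => u u1 v.
have : b <= u * b by rewrite ler_peMl.
have : u * (b * (expR (- h) * s + 1)) <= u * (b * s).
  by rewrite ler_wpM2l ?(le_trans ler01) // ler_wpM2l.
by rewrite !mulrDr mulr1; lra.
Qed.

End Recursion.

Section OneStep.
Context (R : realType) (N : nat) d (A : measurableType d).
Variable mu : probability A R.
Local Notation C := R[i].
Local Notation E := 'M[R[i]]_N.
Implicit Types (X Y Z rho : E).
Variables (W sigma : E) (L F : A -> superop R N) (Lam eta tau c0 C0 : R).
Hypotheses (Wu : W \in unitmx) (sst : is_state sigma)
  (wsig : forall Y, wdot W sigma Y = complex.Re (\tr Y)).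
Hypotheses (Lam0 : 0 < Lam) (tau0 : 0 < tau) (c00 : 0 < c0) (C00 : 0 < C0).
Hypotheses (mL : measurable_superop L) (mF : measurable_superop F).
Hypotheses (Llin : forall a c X Y, L a (c%:C *: X + Y) = c%:C *: L a X + L a Y)
  (Lbd : forall a X, wnorm W (L a X) <= 4 * Lam * wnorm W X).
Hypothesis Fch : forall a, is_channel (F a).
Local Notation Lbar := (mean_superop mu L).
Local Notation Fbar := (mean_superop mu F).
Hypotheses (gap : forall Y, \tr Y = 0 -> wdot W Y (Lbar Y) <= - (eta * wdot W Y Y))
  (Lsig : Lbar sigma = 0).
Hypotheses (tauLam : tau * Lam <= c0) (taueta : eta * tau <= c0).
Hypothesis Ferr : forall rho a, is_state rho ->
  wnorm W (superexp tau (L a) rho - F a rho) <= C0 * Lam ^+ 2 * tau ^+ 2 * wnorm W rho.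

Let kap := Lam ^+ 2 * tau ^+ 2.
(** The first summand bounds the Taylor remainder for operator norm 4 [Lam], using [tauLam]; the
    second is the algorithmic error. *)
Let K := 16 * expR (4 * c0) + C0.

Let kap0 : 0 <= kap. Proof. by rewrite mulr_ge0 ?sqr_ge0. Qed.
Let K0 : 0 <= K. Proof. by rewrite addr_ge0 ?mulr_ge0 ?expR_ge0 // ltW. Qed.

Lemma local_error rho a : is_state rho ->
  wnorm W (F a rho - rho - tau%:C *: L a rho) <= K * kap * wnorm W rho.
Proof.
move=> rs.
have e : F a rho - rho - tau%:C *: L a rho =
    (superexp tau (L a) rho - rho - tau%:C *: L a rho) - (superexp tau (L a) rho - F a rho).
  move: (superexp _ _ _) (tau%:C *: _) => S T.
  by rewrite opprB [RHS]addrC -!addrA addKr.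
rewrite e; apply: le_trans (wnormB _ _ _) _.
have h1 := superexp_taylor Wu (mulr_ge0 (ler0n R 4) (ltW Lam0)) (ltW tau0) (Lbd a) rho.
apply: le_trans (lerD h1 (Ferr a rs)) _.
rewrite -mulrDl ler_wpM2r ?wnorm_ge0 //.
have e4 : expR (tau * (4 * Lam)) <= expR (4 * c0) by rewrite ler_expR mulrCA ler_wpM2l.
rewrite /K [leRHS]mulrDl /kap; apply: lerD; last by rewrite mulrA.
have -> : (tau * (4 * Lam)) ^+ 2 = 16 * (Lam ^+ 2 * tau ^+ 2) by ring.
rewrite [leRHS](_ : _ = 16 * (Lam ^+ 2 * tau ^+ 2) * expR (4 * c0)); last by ring.
by rewrite ler_wpM2l // mulr_ge0.
Qed.

(** By [wsig], [sigma] is a unit vector orthogonal to traceless matrices, so the second part is the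
    theorem of Pythagoras. *)
Lemma state_wdot rho : is_state rho ->
  \tr (rho - sigma) = 0 /\ wdot W rho rho = 1 + wdot W (rho - sigma) (rho - sigma).
Proof.
move=> rs; split; first by rewrite raddfB /= rs.2 sst.2 subrr.
by rewrite !(wdotBr, wdotBl) (wdotC W rho sigma) !wsig rs.2 sst.2 /=; ring.
Qed.

Lemma state_wnorm rho : is_state rho ->
  [/\ 1 <= wnorm W rho, wnorm W (rho - sigma) <= wnorm W rho
    & wnorm W rho <= 1 + wnorm W (rho - sigma)].
Proof.
move=> rs; have [_ e] := state_wdot rs.
have := wnorm_ge0 W rho; have := wnorm_ge0 W (rho - sigma).
move: e; rewrite -!sqr_wnorm; move: (wnorm _ _) (wnorm _ _) => x y e y0 x0.
by split; apply: ler_of_sqr => //; rewrite ?e; nra.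
Qed.

Lemma bmatrix_L X : bmatrix (fun a => L a X).
Proof. by apply: (bmatrix_bounded Wu mL) => a; exact: Lbd. Qed.

(** [Ferr] bounds [F a] on states uniformly in [a]; such bounds survive linear combinations, so
    [state_span] applies. *)
Lemma bmatrix_F X : bmatrix (fun a => F a X).
Proof.
suff [J hJ] : exists J, forall a, wnorm W (F a X) <= J by exact: (bmatrix_bounded Wu mF hJ).
apply: (@state_span _ _ (fun X => exists J, forall a, wnorm W (F a X) <= J)).
- exists 0 => a; have [lin _ _] := Fch a.
  have := lin (-1) 0 0; rewrite scaler0 addr0 scaleN1r addNr => ->.
  by rewrite wnorm0.
- move=> c Y Z [JY hY] [JZ hZ].
  exists ((`|complex.Re c| + `|complex.Im c|) * JY + JZ) => a.
  have [lin _ _] := Fch a; rewrite lin (le_trans (wnormD _ _ _)) // lerD //.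
  by rewrite (le_trans (wnormZC _ _ _)) // ler_wpM2l // addr_ge0.
- move=> rho rs.
  exists (K * kap * wnorm W rho + (wnorm W rho + tau * (4 * Lam * wnorm W rho))) => a.
  have -> : F a rho = (F a rho - rho - tau%:C *: L a rho) + (rho + tau%:C *: L a rho).
    by rewrite addrACA subrK addNr addr0.
  apply: le_trans (wnormD _ _ _) _; apply: lerD; first exact: local_error.
  apply: le_trans (wnormD _ _ _) _; apply: lerD => //.
  by rewrite wnormZ gtr0_norm // ler_wpM2l // ltW.
Qed.

Lemma Lbar_lin c X Y : Lbar (c%:C *: X + Y) = c%:C *: Lbar X + Lbar Y.
Proof. by apply: mean_superop_rlin => [Z|a]; [exact: bmatrix_L|exact: Llin]. Qed.

(** To bound the norm of a mean, pair it with itself, move the functional under the integral, apply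
    Cauchy-Schwarz pointwise and cancel one factor. [mean_error] repeats the argument. *)
Lemma wnorm_Lbar X : wnorm W (Lbar X) <= 4 * Lam * wnorm W X.
Proof.
have [->|n0] := eqVneq (wnorm W (Lbar X)) 0.
  by rewrite !mulr_ge0 ?wnorm_ge0 // ltW.
have np : 0 < wnorm W (Lbar X) by rewrite lt_neqAle eq_sym n0 wnorm_ge0.
rewrite -(ler_pM2l np) -expr2 sqr_wnorm.
rewrite (rlinear_mean mu (@wdot_rlinear R N W (Lbar X)) (bmatrix_L X)).
rewrite -[leRHS](bintegral_cst mu); apply: le_bintegral.
- exact: (bmatrix_rlinear (@wdot_rlinear R N W (Lbar X)) (bmatrix_L X)).
- exact: bmeasurable_cst.
- by move=> a; apply: le_trans (wdot_le _ _ _) _; rewrite ler_wpM2l ?wnorm_ge0.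
Qed.

Lemma mean_wdot Z rho : wdot W Z (Fbar rho - rho - tau%:C *: Lbar rho) =
  \int[mu]_a wdot W Z (F a rho - rho - tau%:C *: L a rho).
Proof.
have wl := @wdot_rlinear R N W Z.
have bF := bmatrix_rlinear wl (bmatrix_F rho).
have bL := bmatrix_rlinear wl (bmatrix_L rho).
under eq_Rintegral do rewrite 2!wdotBr wdotZr -addrA -opprD -mulN1r.
rewrite 2!wdotBr wdotZr (rlinear_mean mu wl (bmatrix_F rho)) (rlinear_mean mu wl (bmatrix_L rho)).
have bcL : bmeasurable (fun a => wdot W Z rho + tau * wdot W Z (L a rho)).
  by apply: bmeasurableD; [exact: bmeasurable_cst|exact: bmeasurableZ].
rewrite (bintegralD mu bF (bmeasurableZ _ bcL)) (bintegralZ mu _ bcL).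
rewrite (bintegralD mu (bmeasurable_cst _ _) (bmeasurableZ _ bL)) (bintegralZ mu _ bL).
by rewrite bintegral_cst; ring.
Qed.

Lemma mean_error rho : is_state rho ->
  wnorm W (Fbar rho - rho - tau%:C *: Lbar rho) <= K * kap * wnorm W rho.
Proof.
move=> rs; set Z := Fbar rho - rho - _.
have [->|n0] := eqVneq (wnorm W Z) 0.
  exact: (mulr_ge0 (mulr_ge0 K0 kap0) (wnorm_ge0 W rho)).
have np : 0 < wnorm W Z by rewrite lt_neqAle eq_sym n0 wnorm_ge0.
rewrite -(ler_pM2l np) -expr2 sqr_wnorm {2}/Z mean_wdot.
rewrite -[leRHS](bintegral_cst mu); apply: le_bintegral.
- apply: (bmatrix_rlinear (@wdot_rlinear R N W Z)).
  apply: bmatrixB; first by exact: (bmatrixB (bmatrix_F rho) (@bmatrix_cst R N d A rho)).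
  rewrite (_ : (fun _ => _) = fun a => tau%:C *: L a rho + 0).
    exact: (bmatrix_lin tau (bmatrix_L rho) (@bmatrix_cst R N d A 0)).
  by apply/funext => a; rewrite addr0.
- exact: bmeasurable_cst.
- move=> a; apply: le_trans (wdot_le _ _ _) _; rewrite ler_wpM2l ?wnorm_ge0 //.
  exact: local_error.
Qed.

Lemma Fbar_state rho : is_state rho -> is_state (Fbar rho).
Proof.
by move=> rs; apply: mean_superop_state => [|a]; [exact: bmatrix_F|exact: channel_state].
Qed.

Let Lbar_diff rho : Lbar rho = Lbar (rho - sigma).
Proof.
have := Lbar_lin (-1) sigma rho.
by rewrite rmorphN1 !scaleN1r Lsig oppr0 add0r addrC => ->.
Qed.

(** The 8 is half of the 16 in |D + tau Lbar D|^2 <= (1 - 2 eta tau + 16 kap) |D|^2. The local error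
    K kap |rho| <= K kap (1 + |D|) yields the additive term and, through [expR_add_le] with
    [taueta], the summand [K * expR c0]. *)
Lemma average_step rho : is_state rho ->
  wnorm W (Fbar rho - sigma) <=
  expR (- (eta * tau) + (8 + K * expR c0) * kap) * wnorm W (rho - sigma) + K * kap.
Proof.
move=> rs; set D := rho - sigma; have [tD _] := state_wdot rs.
have [_ _ rD] := state_wnorm rs; rewrite -/D in tD rD.
set r := Fbar rho - rho - tau%:C *: Lbar rho.
have e : Fbar rho - sigma = (tau%:C *: Lbar D + D) + r.
  rewrite /r -Lbar_diff /D; move: (Fbar rho) (tau%:C *: _) => S T.
  by rewrite [RHS]addrC [RHS]addrA subrK addrA subrK.
rewrite e; apply: le_trans (wnormD _ _ _) _.
have hr : wnorm W r <= K * kap * (1 + wnorm W D).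
  by apply: le_trans (mean_error rs) _; rewrite ler_wpM2l // mulr_ge0.
have hD : wnorm W (tau%:C *: Lbar D + D) <= expR (- (eta * tau) + 8 * kap) * wnorm W D.
  clearbody D; apply: ler_of_sqr; first by rewrite mulr_ge0 ?expR_ge0 ?wnorm_ge0.
  rewrite exprMn -expRM_natl !sqr_wnorm !(wdotDr, wdotDl, wdotZr, wdotZl).
  have h1 := gap tD.
  have h2 : wdot W (Lbar D) (Lbar D) <= 16 * Lam ^+ 2 * wdot W D D.
    have -> : 16 * Lam ^+ 2 * wdot W D D = (4 * Lam * wnorm W D) ^+ 2.
      by rewrite exprMn sqr_wnorm; ring.
    by rewrite -sqr_wnorm ler_pXn2r ?nnegrE ?mulr_ge0 ?wnorm_ge0 ?wnorm_Lbar // ltW.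
  have h3 : 1 + 2%:R * (- (eta * tau) + 8 * kap) <= expR (2%:R * (- (eta * tau) + 8 * kap)).
    exact: expR_ge1Dx.
  have h4 := ler_wpM2r (wdot_ge0 W D) h3; apply: le_trans h4.
  rewrite (wdotC W (Lbar D) D).
  have := ler_wpM2l (ltW tau0) h1; have := ler_wpM2l (sqr_ge0 tau) h2; rewrite /kap.
  move: (wdot W D D) (wdot W D (Lbar D)) (wdot W (Lbar D) (Lbar D)) => x y z h5 h6.
  rewrite [leRHS](_ : _ = x + 2 * (tau * - (eta * x)) + tau ^+ 2 * (16 * Lam ^+ 2 * x)); last by ring.
  by rewrite [leLHS](_ : _ = x + 2 * (tau * y) + tau ^+ 2 * z); [lra|ring].
have hE : expR (- (eta * tau) + 8 * kap) + K * kap <=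
    expR (- (eta * tau) + (8 + K * expR c0) * kap).
  have -> : - (eta * tau) + (8 + K * expR c0) * kap =
      (- (eta * tau) + 8 * kap) + K * kap * expR c0 by ring.
  apply: expR_add_le; last by rewrite mulr_ge0.
  have : 0 <= 8 * kap by rewrite mulr_ge0.
  by move: taueta; lra.
apply: le_trans (lerD hD hr) _; have := ler_wpM2r (wnorm_ge0 W D) hE.
by rewrite mulrDl mulrDr mulr1; lra.
Qed.

(** The doubled cross term gives [2 * K], the squared increment gives the rest. *)
Let K3 := 2 * K + (4 + K * c0) ^+ 2.

(** One step moves [rho] by at most (4 Lam tau + K kap) |rho|, and kap = (Lam tau)^2 <= c0 Lam
    tau. *)
Lemma increment_le rho a : is_state rho ->
  wdot W (F a rho - rho) (F a rho - rho) <= (4 + K * c0) ^+ 2 * kap * wdot W rho rho.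
Proof.
move=> rs; rewrite -!sqr_wnorm.
have -> : (4 + K * c0) ^+ 2 * kap * wnorm W rho ^+ 2 =
   ((4 + K * c0) * (Lam * tau) * wnorm W rho) ^+ 2 by rewrite /kap; ring.
have Kc : 0 <= 4 + K * c0 by rewrite addr_ge0 // mulr_ge0 // ltW.
rewrite ler_pXn2r ?nnegrE ?wnorm_ge0 //; last first.
  by rewrite !mulr_ge0 ?wnorm_ge0 // ltW.
have -> : F a rho - rho = (F a rho - rho - tau%:C *: L a rho) + tau%:C *: L a rho.
  by rewrite subrK.
apply: le_trans (wnormD _ _ _) _; rewrite wnormZ gtr0_norm //.
apply: le_trans (lerD (local_error a rs) (ler_wpM2l (ltW tau0) (Lbd a rho))) _.
rewrite [X in _ + X]mulrA -mulrDl ler_wpM2r ?wnorm_ge0 //.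
have h1 : 0 <= Lam * tau by rewrite mulr_ge0 // ltW.
have h2 : Lam * tau * (Lam * tau) <= c0 * (Lam * tau) by rewrite ler_wpM2r // mulrC.
have := ler_wpM2l K0 h2.
rewrite /kap (_ : K * (Lam * tau * (Lam * tau)) = K * (Lam ^+ 2 * tau ^+ 2)); last by ring.
by rewrite mulrDl mulrA; lra.
Qed.

(* Expands [|F_a rho|^2 = |rho|^2 + 2 <rho, F_a rho - rho> + |F_a rho - rho|^2];
   in the mean, [rho] can be replaced by [rho - sigma] in the cross term because
   [F_a rho - rho] is traceless. *)
Lemma random_step rho : is_state rho ->
  \int[mu]_a wdot W (F a rho) (F a rho) <=
  1 + (expR (- (2 * (eta * tau)) + K3 * kap) * (wdot W rho rho - 1) + K3 * kap).
Proof.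
move=> rs; have [tD eD] := state_wdot rs; have [r1 Dr _] := state_wnorm rs.
set D := rho - sigma in tD eD Dr.
have dec a : wdot W (F a rho) (F a rho) = wdot W rho rho +
    (2 * wdot W rho (F a rho - rho) + wdot W (F a rho - rho) (F a rho - rho)).
  by rewrite !(wdotBr, wdotBl) (wdotC W (F a rho) rho); ring.
have bd : bmatrix (fun a => F a rho - rho).
  exact: (bmatrixB (bmatrix_F rho) (@bmatrix_cst R N d A rho)).
have wl := @wdot_rlinear R N W rho.
have b1 := bmatrix_rlinear wl bd.
have b2 := bmatrix_wdot W bd bd.
under eq_Rintegral do rewrite dec.
rewrite (bintegralD mu (bmeasurable_cst _ _) (bmeasurableD (bmeasurableZ 2 b1) b2)).
rewrite bintegral_cst (bintegralD mu (bmeasurableZ 2 b1) b2) (bintegralZ mu 2 b1).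
have i2 : \int[mu]_a wdot W (F a rho - rho) (F a rho - rho) <=
    (4 + K * c0) ^+ 2 * kap * wdot W rho rho.
  rewrite -[leRHS](bintegral_cst mu); apply: le_bintegral => // [|a].
    exact: bmeasurable_cst.
  exact: increment_le.
have i1 : \int[mu]_a wdot W rho (F a rho - rho) = wdot W D (Fbar rho - rho).
  have bF := bmatrix_rlinear wl (bmatrix_F rho).
  have -> : wdot W D (Fbar rho - rho) = wdot W rho (Fbar rho - rho).
    by rewrite /D wdotBl wsig raddfB /= (Fbar_state rs).2 rs.2 subrr subr0.
  under eq_Rintegral do rewrite wdotBr.
  rewrite wdotBr (rlinear_mean mu wl (bmatrix_F rho)).
  by rewrite (bintegralD mu bF (bmeasurable_cst _ _)) bintegral_cst.
rewrite i1.
have i3 : wdot W D (Fbar rho - rho) <= - (eta * tau) * wdot W D D + K * kap * wdot W rho rho.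
  have -> : Fbar rho - rho = (Fbar rho - rho - tau%:C *: Lbar rho) + tau%:C *: Lbar rho.
    by rewrite subrK.
  rewrite wdotDr wdotZr addrC; apply: lerD.
    rewrite (Lbar_diff rho) -/D; have := ler_wpM2l (ltW tau0) (gap tD).
    by move=> h; rewrite (le_trans h) // le_eqVlt; apply/orP; left; apply/eqP; ring.
  (* Using |D| <= |rho| keeps the error quadratic in |rho|. *)
  apply: le_trans (wdot_le _ _ _) _.
  rewrite -sqr_wnorm expr2 mulrCA; apply: ler_pM; rewrite ?wnorm_ge0 //.
  exact: mean_error.
have h3 : 1 + (- (2 * (eta * tau)) + K3 * kap) <= expR (- (2 * (eta * tau)) + K3 * kap).
  exact: expR_ge1Dx.
have := ler_wpM2r (wdot_ge0 W D) h3; move: i2 i3; rewrite eD.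
rewrite (_ : 1 + wdot W D D - 1 = wdot W D D); last by ring.
rewrite /K3; move: (\int[mu]_a _) (wdot W D (Fbar rho - rho)) => I J.
move: (wdot W D D) (expR _) => x e i2 i3 h4.
have -> : e * x + (2 * K + (4 + K * c0) ^+ 2) * kap =
   e * x + (2 * (K * kap) + (4 + K * c0) ^+ 2 * kap) by ring.
move: h4; have -> : (1 + (- (2 * (eta * tau)) + (2 * K + (4 + K * c0) ^+ 2) * kap)) * x =
   x + 2 * (- (eta * tau) * x) + (2 * (K * kap * x) + (4 + K * c0) ^+ 2 * kap * x) by ring.
move: i2 i3; rewrite !mulrDr !mulr1.
by move: (K * kap) (K * kap * x) ((4 + K * c0) ^+ 2 * kap) ((4 + K * c0) ^+ 2 * kap * x) => u1 u2 u3 u4; lra.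
Qed.

End OneStep.

(** * Trajectories of the random channel *)

Section RandomTrajectory.
Context (R : realType) (N : nat) d d' (A : measurableType d) (Omega : measurableType d').
Variables (mu : probability A R) (P : probability Omega R) (M : nat).
Variables (a : 'I_M -> {RV P >-> A}) (F : A -> superop R N) (W rho : 'M[R[i]]_N) (q b : R).
Hypotheses (iid : iid_samples mu a) (Fch : forall x, is_channel (F x))
  (bF : forall X, bmatrix (fun x => F x X)) (rs : is_state rho).
Hypothesis (step : forall X, is_state X ->
     \int[mu]_x wdot W (F x X) (F x X) <= 1 + (q * (wdot W X X - 1) + b)).

(** Truncating the enumeration makes this defined for every [m] without building an ordinal, and
    [m = M] gives the composed channel. *)
Definition trajectory m w : 'M[R[i]]_N :=
  foldl (fun Y k => F (a k w) Y) rho (take m (enum 'I_M)).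

Lemma trajectoryS (m : 'I_M) w : trajectory m.+1 w = F (a m w) (trajectory m w).
Proof.
rewrite /trajectory (take_nth m) ?size_enum_ord // nth_ord_enum.
by rewrite foldl_rcons.
Qed.

Lemma trajectory_state m w : is_state (trajectory m w).
Proof.
rewrite /trajectory; elim/last_ind: (take m _) => [//|s k IH].
by rewrite foldl_rcons; exact: channel_state.
Qed.

Lemma composed_trajectory w :
  composed_superop F [seq a i w | i <- enum 'I_M] rho = trajectory M w.
Proof.
rewrite /composed_superop /trajectory -[X in take X]size_enum_ord take_size.
by elim: (enum _) rho => //= k s IH X; rewrite IH.
Qed.

Let Frl x c X Y : F x (c%:C *: X + Y) = c%:C *: F x X + F x Y.
Proof. by have [lin _ _] := Fch x; rewrite lin. Qed.

Let rlinear_F f x : rlinear f -> rlinear (fun X => f (F x X)).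
Proof. by move=> fl c X Y; rewrite Frl fl. Qed.

(** By linearity of the channels, such a product at time [m.+1] is a finite sum of products at time
    [m] times functions of the sample [m] alone. Pairs are used because the squared norm is
    quadratic in the coordinates. *)
Lemma coord_trajectory m p r : (m <= M)%N ->
  indep_future mu a m (fun w => coord p (trajectory m w) * coord r (trajectory m w)).
Proof.
elim: m p r => [|m IH] p r mM.
  rewrite (_ : (fun _ => _) = fun=> coord p rho * coord r rho).
    exact: indep_future_cst.
  by apply/funext => w; rewrite /trajectory take0.
pose k := Ordinal mM.
rewrite (_ : (fun _ => _) = fun w => \sum_s \sum_t
    (coord s (trajectory m w) * coord t (trajectory m w)) *
    (coord p (F (a k w) (mbase R s)) * coord r (F (a k w) (mbase R t)))).
  apply: indep_future_sum => // s; apply: indep_future_sum => // t.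
  pose v x := coord p (F x (mbase R s)) * coord r (F x (mbase R t)).
  have bv : bmeasurable v by apply: bmeasurableM; exact: bF.
  by have [] := indep_future_step (m := k) (IH s t (ltnW mM)) bv.
apply/funext => w; rewrite (trajectoryS k).
rewrite (rlinear_coord _ (rlinear_F (a k w) (@coord_rlinear _ _ p))).
rewrite (rlinear_coord _ (rlinear_F (a k w) (@coord_rlinear _ _ r))).
rewrite mulr_suml; apply: eq_bigr => s _; rewrite mulr_sumr; apply: eq_bigr => t _.
by rewrite mulrACA.
Qed.

Lemma bmatrix_trajectory_wdot m : (m <= M)%N ->
  bmeasurable (fun w => wdot W (trajectory m w) (trajectory m w)).
Proof.
move=> mM; under [X in bmeasurable X]eq_fun do rewrite wdot_coord.
apply: bmeasurable_sum => s; apply: bmeasurable_sum => t.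
by apply: bmeasurableM; [exact: (coord_trajectory s t mM).1|exact: bmeasurable_cst].
Qed.

Let F2 s t x := wdot W (F x (mbase R s)) (F x (mbase R t)).

Let wdotF x X : wdot W (F x X) (F x X) =
  \sum_s \sum_t coord s X * coord t X * F2 s t x.
Proof.
have e1 := rlinear_coord X (rlinear_F x (@wdot_rlinear _ _ W (F x X))).
rewrite e1; apply: eq_bigr => s _.
have e2 := rlinear_coord X (rlinear_F x (@wdot_rlinear _ _ W (F x (mbase R s)))).
by rewrite wdotC e2 mulr_sumr; apply: eq_bigr => t _; rewrite mulrA.
Qed.

Let bF2 s t : bmeasurable (F2 s t).
Proof. exact: bmatrix_wdot. Qed.

Lemma trajectory_step (m : 'I_M) :
  \int[P]_w wdot W (trajectory m.+1 w) (trajectory m.+1 w) <=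
  1 + (q * (\int[P]_w wdot W (trajectory m w) (trajectory m w) - 1) + b).
Proof.
have mM : (m <= M)%N := ltnW (ltn_ord m).
have bw := bmatrix_trajectory_wdot mM.
pose f s t w := coord s (trajectory m w) * coord t (trajectory m w).
have bf s t : bmeasurable (f s t) by exact: (coord_trajectory s t mM).1.
have bfF s t : bmeasurable (fun w => f s t w * F2 s t (a m w)).
  apply: bmeasurableM => //; apply: (bmeasurable_comp _ (bF2 s t)).
  exact: measurable_funPT.
have bfc s t : bmeasurable (fun w => f s t w * \int[mu]_x F2 s t x).
  by apply: bmeasurableM => //; exact: bmeasurable_cst.
(* [J] plays the role of the conditional expectation given the first [m] samples: the trajectory is
   frozen and only the fresh sample is averaged. *)
pose J w := \int[mu]_x wdot W (F x (trajectory m w)) (F x (trajectory m w)).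
have JE : J = fun w => \sum_s \sum_t f s t w * \int[mu]_x F2 s t x.
  apply/funext => w; rewrite /J; under eq_Rintegral do rewrite wdotF.
  rewrite bintegral_sum => [|s]; last first.
    by apply: bmeasurable_sum => t; exact: bmeasurableZ.
  apply: eq_bigr => s _; rewrite bintegral_sum => [|t]; last exact: bmeasurableZ.
  by apply: eq_bigr => t _; rewrite bintegralZ.
have bJ : bmeasurable J.
  by rewrite JE; apply: bmeasurable_sum => s; exact: bmeasurable_sum.
have -> : \int[P]_w wdot W (trajectory m.+1 w) (trajectory m.+1 w) = \int[P]_w J w.
  under eq_Rintegral do rewrite trajectoryS wdotF.
  rewrite JE [LHS]bintegral_sum => [|s]; last first.
    by apply: bmeasurable_sum => t; exact: bfF.
  rewrite [RHS]bintegral_sum => [|s]; last first.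
    by apply: bmeasurable_sum => t; exact: bfc.
  apply: eq_bigr => s _; rewrite [LHS]bintegral_sum => [|t]; last exact: bfF.
  rewrite [RHS]bintegral_sum => [|t]; last exact: bfc.
  apply: eq_bigr => t _.
  have [-> _] := indep_future_step (coord_trajectory s t mM) (bF2 s t).
  under [RHS]eq_Rintegral do rewrite mulrC.
  by rewrite bintegralZ // mulrC.
have b1 (c : R) : bmeasurable (fun _ : Omega => c) by exact: bmeasurable_cst.
have bw1 := bmeasurableD bw (b1 (- 1)).
have bw2 := bmeasurableD (bmeasurableZ q bw1) (b1 b).
apply: le_trans (le_bintegral P bJ (bmeasurableD (b1 1) bw2)
  (fun w => step (trajectory_state m w))) _.
rewrite (bintegralD P (b1 1) bw2) (bintegralD P (bmeasurableZ q bw1) (b1 b)).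
by rewrite (bintegralZ P q bw1) (bintegralD P bw (b1 (- 1))) !bintegral_cst.
Qed.

End RandomTrajectory.

Section LindbladAlgebra.
Variables (R : realType) (N : nat).
Local Notation C := R[i].
Implicit Types (H V X Y : 'M[R[i]]_N).

Lemma lindblad_lin H V (c : C) X Y :
  lindblad H V (c *: X + Y) = c *: lindblad H V X + lindblad H V Y.
Proof.
pose lin (f : superop R N) := forall X Y, f (c *: X + Y) = c *: f X + f Y.
have lD f g : lin f -> lin g -> lin (fun X => f X + g X).
  by move=> hf hg P Q; rewrite hf hg scalerDr addrACA.
have lZ z f : lin f -> lin (fun X => z *: f X).
  by move=> hf P Q; rewrite hf scalerDr !scalerA mulrC.
have lN f : lin f -> lin (fun X => - f X).
  by move=> hf P Q; rewrite hf opprD scalerN.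
have ll B : lin (fun X => B *m X) by move=> P Q; rewrite mulmxDr -scalemxAr.
have lr B : lin (fun X => X *m B) by move=> P Q; rewrite mulmxDl -scalemxAl.
have lVV : lin (fun X => V *m X *m V^t*).
  by move=> P Q; rewrite (ll V) (lr (V^t*)).
exact: (lD _ _ (lD _ _ (lN _ (lZ 'i%C _ (lD _ _ (ll H) (lN _ (lr H))))) lVV)
  (lN _ (lZ 2^-1 _ (lD _ _ (ll (V^t* *m V)) (lr (V^t* *m V))))) X Y).
Qed.

Lemma lindblad_trace H V X : \tr (lindblad H V X) = 0.
Proof.
have tB P Q : \tr (P - Q) = \tr P - \tr Q :> C by rewrite raddfB.
have tN (P : 'M[C]_N) : \tr (- P) = - \tr P by rewrite raddfN.
rewrite /lindblad tB mxtraceD tN !mxtraceZ tB mxtraceD.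
rewrite (mxtrace_mulC H X) subrr mulr0 oppr0 add0r (mxtrace_mulC X (V^t* *m V)).
rewrite (mxtrace_mulC (V *m X)) mulmxA; move: (\tr _) => t.
by rewrite -mulr2n -[t *+ 2]mulr_natl mulrA mulVf ?mul1r ?subrr // pnatr_eq0.
Qed.

End LindbladAlgebra.

(** * Assembling the constants *)

Section FinalConstants.
Variable R : realType.
Implicit Types x y e k s B : R.

Lemma geometric_const y y0 e k s B1 B : y <= B1 * (e * y0 + k * s) -> B1 <= B ->
  0 <= B -> 0 <= e -> 0 <= y0 -> 0 <= k -> 0 <= s ->
  y <= B * (1 + k) * (e * y0 + s).
Proof.
move=> yB BB B0 e0 y00 k0 s0.
have ey : 0 <= e * y0 by rewrite mulr_ge0.
have ks : 0 <= k * s by rewrite mulr_ge0.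
apply: le_trans yB _; apply: le_trans (ler_wpM2r (addr_ge0 ey ks) BB) _.
rewrite -mulrA ler_wpM2l // mulrDl mul1r mulrDr.
have : 0 <= k * (e * y0) by rewrite mulr_ge0.
by lra.
Qed.

(** For the average channel the recursion bounds the norm, while chi-square is its square. The
    constant comes from (u + k s)^2 <= 2 (1 + k^2) (u^2 + s^2). *)
Lemma geometric_const_sqr x x0 e k s B1 B : x <= B1 * (e * x0 + k * s) -> B1 <= B ->
  0 <= x -> 0 <= B -> 0 <= e -> 0 <= x0 -> 0 <= k -> 0 <= s ->
  x ^+ 2 <= 2 * B ^+ 2 * (1 + k ^+ 2) * (e ^+ 2 * x0 ^+ 2 + s ^+ 2).
Proof.
move=> xB BB x0' B0 e0 x00 k0 s0.
have ex : 0 <= e * x0 by rewrite mulr_ge0.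
have ks : 0 <= k * s by rewrite mulr_ge0.
have {xB BB} xB : x <= B * (e * x0 + k * s).
  by rewrite (le_trans xB) // ler_wpM2r // addr_ge0.
have h1 : x ^+ 2 <= (B * (e * x0 + k * s)) ^+ 2.
  by rewrite ler_pXn2r // nnegrE mulr_ge0 // addr_ge0.
apply: le_trans h1 _; rewrite [leLHS]exprMn.
rewrite [leRHS](_ : _ = B ^+ 2 * (2 * (1 + k ^+ 2) * ((e * x0) ^+ 2 + s ^+ 2))); last by ring.
rewrite ler_wpM2l ?sqr_ge0 //; move: (e * x0) => u.
rewrite -subr_ge0 (_ : _ - _ = (u - k * s) ^+ 2 + 2 * (k * u) ^+ 2 + 2 * s ^+ 2); last by ring.
by do 2?apply: addr_ge0; rewrite ?sqr_ge0 // mulr_ge0 // sqr_ge0.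
Qed.

End FinalConstants.

Unset Implicit Arguments.

Theorem theorem9 (R : realType) (c0 C0 : R) (hc0 : 0 < c0) (hC0 : 0 < C0) :
  exists2 C : R, 0 < C &
  forall (n : nat) (N := (2 ^ n)%N)
    (d : measure_display) (A : measurableType d) (mu : probability A R)
    (H V : A -> 'M[R[i]]_N)
    (L := fun a : A => lindblad (H a) (V a)) (Lbar := mean_superop mu L)
    (sigma : 'M[R[i]]_N) (Ldag LKMS : superop R N) (eta Lambda : R)
    (F : R -> A -> superop R N) (M : nat) (tau : R) (T := tau * M%:R),
  (forall a, H a \is hermsymmx) ->
  measurable_superop L ->
  is_state sigma -> full_rank sigma ->
  primitive Lbar -> invariant_state Lbar sigma ->
  is_adjoint (@hs_ip R N) Lbar Ldag ->
  is_adjoint (kms_ip sigma) Ldag LKMS ->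
  0 < eta ->
  spectral_gap_ge sigma (fun X => 2^-1 *: (Ldag X + LKMS X)) eta ->
  0 < Lambda ->
  (forall a,
    [/\ spectral_norm
          (mxpowR sigma 4^-1 *m H a *m mxpowR sigma (- 4^-1)) <= Lambda,
        spectral_norm
          (mxpowR sigma 4^-1 *m V a *m mxpowR sigma (- 4^-1)) ^+ 2 <= Lambda
      & spectral_norm
          (mxpowR sigma 4^-1 *m (V a)^t* *m mxpowR sigma (- 4^-1)) ^+ 2
        <= Lambda]) ->
  (1 <= M)%N ->
  0 < tau ->
  tau <= c0 * Num.min (1 / eta) (Num.min (1 / Lambda) (1 / (T * Lambda ^+ 2))) ->
  (forall a, is_channel (F tau a)) ->
  measurable_superop (F tau) ->
  (forall rho a, is_state rho ->
    kms_dual_norm sigma (superexp tau (L a) rho - F tau a rho) <=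
    C0 * Lambda ^+ 2 * tau ^+ 2 * kms_dual_norm sigma rho) ->
  forall rho : 'M[R[i]]_N, is_state rho ->
    chi2 (iter M (mean_superop mu (F tau)) rho) sigma <=
      C * (expR (- (2 * eta * tau * M%:R)) * chi2 rho sigma
           + tau ^+ 2 * Lambda ^+ 4 / eta ^+ 2)
  /\
    forall (d' : measure_display) (Omega : measurableType d')
      (P : probability Omega R) (a : 'I_M -> {RV P >-> A}),
    iid_samples mu a ->
    ('E_P[fun w => chi2 (composed_superop (F tau) [seq a i w | i <- enum 'I_M]
                           rho) sigma] <=
      (C * (expR (- (2 * eta * tau * M%:R)) * chi2 rho sigma
            + tau * Lambda ^+ 2 / eta))%:E)%E.
Proof.
pose K := 16 * expR (4 * c0) + C0.
pose K1 := 8 + K * expR c0.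
pose K3 := 2 * K + (4 + K * c0) ^+ 2.
have Kp : 0 < K by rewrite addr_gt0 // mulr_gt0 // expR_gt0.
have K1p : 0 < K1 by rewrite addr_gt0 // mulr_gt0 // expR_gt0.
have K3p : 0 < K3 by rewrite ltr_pwDl ?sqr_ge0 // mulr_gt0.
(* [C1] is the output of [geometric_const_sqr] at [k = K * expR c0], and [C2] that of
   [geometric_const] at [k = K3 * expR (2 * c0)], where the rate is 2 eta tau <= 2 c0. *)
pose C1 := 2 * expR (K1 * c0) ^+ 2 * (1 + (K * expR c0) ^+ 2).
pose C2 := expR (K3 * c0) * (1 + K3 * expR (2 * c0)).
have C1p : 0 < C1.
  by rewrite mulr_gt0 ?mulr_gt0 ?exprn_gt0 ?expR_gt0 // ltr_pwDl ?sqr_ge0.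
have C2p : 0 < C2.
  by rewrite mulr_gt0 ?expR_gt0 // ltr_pwDl // mulr_ge0 ?expR_ge0 // ltW.
exists (C1 + C2); first by rewrite addr_gt0.
move=> n N d A mu H V L Lbar sigma Ldag LKMS eta Lam F M tau T.
clearbody N => hH mL sst rk _ _ adj adjK eta0 gap Lam0 bnd M1 tau0 hmin Fch mF Ferr.
have [psd _] := sst.
have Wd := mxpowR_dag sigma (- 4^-1); have Ud := mxpowR_dag sigma 4^-1.
have WU := mxpowR_quarterV psd rk; have WW := mxpowR_quarterN_sqr psd rk.
have ST := mxpowR_halfV psd rk; have SS := mxpowR_half_sqr psd rk.
have Sd := mxpowR_dag sigma 2^-1.
set W := mxpowR sigma (- 4^-1) in bnd Wd WU WW.
set U := mxpowR sigma 4^-1 in bnd Ud WU.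
clearbody W U.
have Wu := (mulmx1_unit WU).1.
have wsig := wdot_sigmal Wd WW ST SS.
have Lbd a X : wnorm W (L a X) <= 4 * Lam * wnorm W X.
  have [h1 h2 h3] := bnd a.
  by apply: (wnorm_lindblad Wd Ud WU (ltW Lam0) X _ h1 h2 h3); exact/hermsymmxP.
have Llin a c X Y : L a (c%:C *: X + Y) = c%:C *: L a X + L a Y.
  exact: lindblad_lin.
have gapT := wdot_generator_traceless erefl Wd Sd WW ST SS adj adjK gap.
have Lsig : Lbar sigma = 0.
  apply: (generator_sigma0 erefl Wd Sd Wu WW ST SS adj adjK eta0 gap).
    exact: (Lbar_lin mu Wu mL Llin Lbd).
  move=> X; apply: (mean_superop_trace mu (bmatrix_L Wu mL Lbd X)) => a.
  exact: lindblad_trace.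
have dualE := kms_dual_normE erefl Wd WW; have chiE := chi2E erefl Wd WW.
have Ferr' rho a : is_state rho -> wnorm W (superexp tau (L a) rho - F tau a rho) <=
    C0 * Lam ^+ 2 * tau ^+ 2 * wnorm W rho.
  by move=> rs; rewrite -!dualE; exact: Ferr.
have M0 : 0 < M%:R :> R by rewrite ltr0n.
have T0 : 0 < T by rewrite mulr_gt0.
have tmin x y : tau <= c0 * Num.min x y -> tau <= c0 * x /\ tau <= c0 * y.
  by move=> h; split; apply: le_trans h _; rewrite ler_wpM2l ?(ltW hc0) // ge_min lexx ?orbT.
have [te /tmin [tL tT]] := tmin _ _ hmin.
have taueta : eta * tau <= c0 by rewrite mulrC -ler_pdivlMr //; move: te; rewrite div1r.
have tauLam : tau * Lam <= c0 by rewrite -ler_pdivlMr //; move: tL; rewrite div1r.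
pose kap := Lam ^+ 2 * tau ^+ 2.
have kap0 : 0 <= kap by rewrite mulr_ge0 ?sqr_ge0.
have kapM : kap * M%:R <= c0.
  move: tT; rewrite div1r ler_pdivlMr ?mulr_gt0 ?exprn_gt0 // => h.
  by rewrite (le_trans _ h) // /T /kap le_eqVlt; apply/orP; left; apply/eqP; ring.
have h0 : 0 < eta * tau by rewrite mulr_gt0.
move=> rho rs.
have [_ wrho] := state_wdot sst wsig rs.
(* Increment over contraction rate: the level at which the recursions saturate. *)
have kapE : kap / (eta * tau) = tau * Lam ^+ 2 / eta.
  by rewrite /kap; field; rewrite !gt_eqF.
have s0 : 0 <= tau * Lam ^+ 2 / eta by rewrite divr_ge0 ?mulr_ge0 ?sqr_ge0 // ltW.
have eE : expR (- (eta * tau * M%:R)) ^+ 2 = expR (- (2 * eta * tau * M%:R)).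
  by rewrite -expRM_natl; congr expR; ring.
have bndK k : 0 <= k -> expR (k * kap * M%:R) <= expR (k * c0).
  by move=> k0; rewrite ler_expR -mulrA ler_wpM2l.
have chi0 X : 0 <= chi2 X sigma by exact: sqr_ge0.
have rhs0 z : 0 <= z -> 0 <= expR (- (2 * eta * tau * M%:R)) * chi2 rho sigma + z.
  by move=> z0; rewrite addr_ge0 // mulr_ge0 ?expR_ge0.
split.
  pose x m := wnorm W (iter m (mean_superop mu (F tau)) rho - sigma).
  have st m : is_state (iter m (mean_superop mu (F tau)) rho).
    elim: m => [|m IH]; first exact: rs.
    exact: (Fbar_state mu Wu Lam0 tau0 mF Lbd Fch tauLam Ferr' IH).
  have xS m : (m < M)%N -> x m.+1 <= expR (- (eta * tau) + K1 * kap) * x m + K * kap.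
    move=> _; exact: (average_step Wu sst wsig Lam0 tau0 hC0 mL mF Llin Lbd Fch
      gapT Lsig tauLam taueta Ferr' (st m)).
  have := geometric_recursion h0 taueta (mulr_ge0 (ltW K1p) kap0)
    (mulr_ge0 (ltW Kp) kap0) xS.
  have -> : K * kap * (expR c0 / (eta * tau)) = K * expR c0 * (tau * Lam ^+ 2 / eta).
    by rewrite -kapE; ring.
  move=> /geometric_const_sqr /(_ (bndK _ (ltW K1p))) h.
  have {h} := h (wnorm_ge0 _ _) (expR_ge0 _) (expR_ge0 _) (wnorm_ge0 _ _)
    (mulr_ge0 (ltW Kp) (expR_ge0 _)) s0.
  rewrite eE /x /= !sqr_wnorm -!chiE -/C1.
  have sE : (tau * Lam ^+ 2 / eta) ^+ 2 = tau ^+ 2 * Lam ^+ 4 / eta ^+ 2.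
    by field; rewrite gt_eqF.
  rewrite sE.
  move=> /le_trans; apply; rewrite ler_wpM2r ?lerDl ?(ltW C2p) // rhs0 //.
  by rewrite -sE sqr_ge0.
move=> d' Omega P a iid.
have bF := bmatrix_F Wu Lam0 tau0 mF Lbd Fch tauLam Ferr'.
pose tr m w := trajectory a (F tau) rho m w.
(* By [state_wdot], subtracting 1 turns the mean squared norm into the mean chi-square. *)
pose y m := \int[P]_w wdot W (tr m w) (tr m w) - 1.
have bw := bmatrix_trajectory_wdot W rho iid Fch bF (leqnn M).
have chiT : (fun w => chi2 (composed_superop (F tau) [seq a i w | i <- enum 'I_M] rho) sigma)
    = fun w => wdot W (tr M w) (tr M w) + (- 1).
  apply/funext => w; rewrite composed_trajectory chiE.
  have [_ ->] := state_wdot sst wsig (trajectory_state a Fch rs M w).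
  by rewrite -/(tr M w); ring.
have b1 : bmeasurable (fun _ : Omega => - 1 : R) by exact: bmeasurable_cst.
rewrite chiT expectation_bintegral ?lee_fin; last exact: bmeasurableD.
rewrite (bintegralD P bw b1) bintegral_cst -/(y M).
have y0 : y 0%N = chi2 rho sigma.
  rewrite /y /tr /trajectory take0 /= bintegral_cst chiE wrho; ring.
pose h := 2 * (eta * tau).
have hp : 0 < h by rewrite mulr_gt0.
have hc : h <= 2 * c0 by rewrite ler_wpM2l.
have stp X : is_state X -> \int[mu]_x wdot W (F tau x X) (F tau x X) <=
    1 + (expR (- h + K3 * kap) * (wdot W X X - 1) + K3 * kap).
  exact: (random_step Wu sst wsig Lam0 tau0 hc0 hC0 mL mF Llin Lbd Fch gapT Lsig
    tauLam Ferr').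
have yS m : (m < M)%N -> y m.+1 <= expR (- h + K3 * kap) * y m + K3 * kap.
  move=> mM; have := trajectory_step iid Fch bF rs stp (Ordinal mM).
  by rewrite /y lerBlDl.
have := geometric_recursion hp hc (mulr_ge0 (ltW K3p) kap0) (mulr_ge0 (ltW K3p) kap0) yS.
have -> : expR (- (h * M%:R)) = expR (- (2 * eta * tau * M%:R)).
  by congr expR; rewrite /h; ring.
have -> : K3 * kap * (expR (2 * c0) / h) = K3 * expR (2 * c0) * (tau * Lam ^+ 2 / eta / 2).
  by rewrite -kapE /h; field; rewrite !gt_eqF.
have s2 : 0 <= tau * Lam ^+ 2 / eta / 2 by rewrite divr_ge0.
rewrite y0 => /geometric_const /(_ (bndK _ (ltW K3p))) g.
have {g} := g (expR_ge0 _) (expR_ge0 _) (chi0 _)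
  (mulr_ge0 (ltW K3p) (expR_ge0 _)) s2.
rewrite -/C2 => /le_trans; apply.
apply: le_trans (_ : C2 * (expR (- (2 * eta * tau * M%:R)) * chi2 rho sigma +
    tau * Lam ^+ 2 / eta) <= _); first by rewrite ler_wpM2l ?(ltW C2p) // lerD2l; lra.
by rewrite ler_wpM2r ?rhs0 // lerDr ltW.
Qed.
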